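(* Let $k$ be an algebraically closed field with $\mathrm{char}(k) > n$, and let $m \ge 2$, $n \ge 4$, $1 \le h \le n-3$ be integers. Then the singular locus of $X_{m,n,h}$ has codimension $2h+3$ in $X_{m,n,h}$.
   Context: For $0 \le j \le n$, $e_n^j$ denotes the elementary symmetric polynomial of degree $j$ in $n$ variables. With homogeneous coordinates $z_{i,j}$ ($1 \le i \le m$, $1 \le j \le n$) on $\mathbb{P}^{mn-1}_k$, $X_{m,n,h}$ is the closed subscheme defined by $e_n^j(z_{1,1},\dots,z_{1,n}) = e_n^j(z_{i,1},\dots,z_{i,n})$ for $2 \le i \le m$, $1 \le j \le n-h-1$; it is a complete intersection of dimension $n+(m-1)(h+1)-1$. *)

(* Defs.v *)
From HB Require Import structures.
From mathcomp Require Import all_boot all_order all_algebra.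
From mathcomp Require Import mpoly.
Set Implicit Arguments. Unset Strict Implicit. Unset Printing Implicit Defensive.
Import GRing.Theory.
Local Open Scope ring_scope.

Section Alg.
Variables (k : fieldType) (N : nat).

Definition aset := ('I_N -> k) -> Prop.

Definition zariski_closed (S : aset) : Prop :=
  exists P : {mpoly k[N]} -> Prop, forall v, S v <-> (forall p, P p -> p.@[v] = 0).

Definition subset_of (A B : aset) : Prop := forall v, A v -> B v.

Definition irreducible_closed (Z : aset) : Prop :=
  zariski_closed Z /\ (exists v, Z v) /\
  forall A B : aset, zariski_closed A -> zariski_closed B ->
    (forall v, Z v <-> (A v \/ B v)) -> subset_of Z A \/ subset_of Z B.

Definition irr_chain (S : aset) (d : nat) : Prop :=
  exists Z : nat -> aset,
    (forall i, (i <= d)%N -> irreducible_closed (Z i) /\ subset_of (Z i) S) /\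
    (forall i, (i < d)%N -> subset_of (Z i) (Z i.+1) /\ ~ subset_of (Z i.+1) (Z i)).

Definition has_dim (S : aset) (d : nat) : Prop :=
  irr_chain S d /\ ~ irr_chain S d.+1.

End Alg.

Section X.
Variables (k : fieldType) (m n h : nat).

Definition zvar (i : 'I_m) (j : 'I_n) : {mpoly k[m * n]} := 'X_(mxvec_index i j).

Definition esym_row (i : 'I_m) (d : nat) : {mpoly k[m * n]} :=
  \sum_(s : {set 'I_n} | #|s| == d) \prod_(c in s) zvar i c.

(* Equation indices: (i, b) with i : 'I_m, i <> 0 (rows 2..m) and
   b : 'I_(n-h-1) (degree j = b+1, 1 <= j <= n-h-1). *)
Definition eq_index := ('I_m * 'I_(n - h - 1))%type.

Lemma first_row_lt (i : 'I_m) : (0 < m)%N.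
Proof. exact: leq_ltn_trans (leq0n i) (ltn_ord i). Qed.

Definition row1 (i : 'I_m) : 'I_m := Ordinal (first_row_lt i).

(* defining equation e^j(z_{1,*}) - e^j(z_{i,*}) for paper row i+1 >= 2,
   j = b+1; index pairs with i = 0 give the zero polynomial (not an equation). *)
Definition Xeq (ib : eq_index) : {mpoly k[m * n]} :=
  let: (i, b) := ib in
  if (i : nat) == 0%N then 0
  else esym_row (row1 i) b.+1 - esym_row i b.+1.

(* points of the affine cone over X_{m,n,h} in k^{mn} *)
Definition Xcone : aset k (m * n) := fun v => forall ib, (Xeq ib).@[v] = 0.

Definition jacobian (v : 'I_(m * n) -> k) : 'M[k]_(#|{: eq_index}|, m * n) :=
  \matrix_(r, l) (mderiv l (Xeq (enum_val r))).@[v].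

(* number of defining equations = codimension of the complete intersection *)
Definition ncodim : nat := (m - 1) * (n - h - 1).

(* affine cone over the singular locus: Jacobian criterion for the complete
   intersection X_{m,n,h} *)
Definition Singcone : aset k (m * n) :=
  fun v => Xcone v /\ (\rank (jacobian v) < ncodim)%N.

End X.

(* Main.v *)
Require Import Defs.
From HB Require Import structures.
From mathcomp Require Import all_boot all_order all_algebra.
From mathcomp Require Import perm zify boolp.
From mathcomp Require classical_sets.
From mathcomp Require Import mpoly.
Set Implicit Arguments. Unset Strict Implicit. Unset Printing Implicit Defensive.
Import GRing.Theory.
Local Open Scope ring_scope.

(** The map sending each row of a point to its elementary symmetric functions is
    a finite surjection of affine spaces, under which the cone over X is the
    preimage of an affine space of dimension n + (m-1)(h+1). Put r = n-h-1. On X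
    all rows share e_1, ..., e_r, and the c-th partial derivative of e_(d+1) at a
    row z is G_d(z_c), where G_d has degree d and depends only on e_1, ..., e_d.
    So a relation between the rows of the Jacobian yields polynomials f_i of
    degree < r, not all zero, with zero sum, f_i vanishing on the coordinates of
    the i-th row: two distinct rows have fewer than r distinct coordinates.
    Conversely the rank drops when two equal rows have fewer than r distinct
    coordinates. Since char k > n, a row with a prescribed pattern of r-1
    distinct coordinates is integral over its first r-1 power sums, so the
    singular cone has dimension (r-1) + (m-2)(h+1).

    A chain of irreducible closed sets of length d yields D^d linearly
    independent functions of degree O(D); when the coordinates are integral over
    d functions there are only O(D^d) of those, which bounds chains from above.
    Chains are lifted from below through one row at a time: symmetrization of a
    row is a closed map with finite fibres, and by Zorn's lemma an irreducible
    closed set Z is the image of a minimal, hence irreducible, closed set. *)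

(** * Closed sets and irreducibility *)

(** Polynomiality is a property of functions, so that maps built by reindexing and case analysis on
    indices need no explicit polynomial. *)
Definition polyfun (k : fieldType) N (f : ('I_N -> k) -> k) :=
  exists p : {mpoly k[N]}, forall v, p.@[v] = f v.

Definition polymap (k : fieldType) N M (F : ('I_N -> k) -> 'I_M -> k) :=
  forall i, polyfun (fun v => F v i).

Section PolynomialFunctions.
Variables (k : fieldType) (N : nat).
Implicit Types f g : ('I_N -> k) -> k.

Lemma polyfun_meval (p : {mpoly k[N]}) : polyfun (fun v => p.@[v]).
Proof. by exists p. Qed.

Lemma polyfun_cst (c : k) : polyfun (fun _ : 'I_N -> k => c).
Proof. by exists c%:MP => v; rewrite mevalC. Qed.

Lemma polyfun_coord (i : 'I_N) : polyfun (fun v : 'I_N -> k => v i).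
Proof. by exists 'X_i => v; rewrite mevalXU. Qed.

Lemma polyfunD f g : polyfun f -> polyfun g -> polyfun (fun v => f v + g v).
Proof. by move=> [p hp] [q hq]; exists (p + q) => v; rewrite mevalD hp hq. Qed.

Lemma polyfunN f : polyfun f -> polyfun (fun v => - f v).
Proof. by move=> [p hp]; exists (- p) => v; rewrite mevalN hp. Qed.

Lemma polyfunB f g : polyfun f -> polyfun g -> polyfun (fun v => f v - g v).
Proof. by move=> hf hg; apply: polyfunD => //; apply: polyfunN. Qed.

Lemma polyfun_comp M (f : ('I_M -> k) -> k) (F : ('I_N -> k) -> 'I_M -> k) :
  polyfun f -> polymap F -> polyfun (fun v => f (F v)).
Proof.
move=> [p hp] /choice[q hq]; exists (p \mPo [tuple q i | i < M]) => v.
rewrite comp_mpoly_meval -hp; apply: meval_eq => i.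
by rewrite tnth_mktuple hq.
Qed.

Lemma polymap_comp M L (G : ('I_M -> k) -> 'I_L -> k) (F : ('I_N -> k) -> 'I_M -> k) :
  polymap G -> polymap F -> polymap (fun v => G (F v)).
Proof. by move=> hG hF i; apply: (polyfun_comp (hG i) hF). Qed.

End PolynomialFunctions.

Section ClosedSets.
Variables (k : fieldType) (N : nat).
Implicit Types A B Z : aset k N.

Lemma zariski_closed_eq (I : Type) (f g : I -> ('I_N -> k) -> k) :
  (forall i, polyfun (f i)) -> (forall i, polyfun (g i)) ->
  zariski_closed (fun v => forall i, f i v = g i v).
Proof.
move=> hf hg; exists (fun p => exists i, forall v, p.@[v] = f i v - g i v) => v.
split=> [h p [i ->]|h i]; first by rewrite h subrr.
have [p hp] := polyfunB (hf i) (hg i).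
by apply/eqP; rewrite -subr_eq0 -hp h //; exists i.
Qed.

Lemma zariski_closed_zero (p : {mpoly k[N]}) : zariski_closed (fun v => p.@[v] = 0).
Proof. by exists (fun q => q = p) => v; split=> [h _ ->//|h]; apply: h. Qed.

Lemma zariski_closedI A B : zariski_closed A -> zariski_closed B ->
  zariski_closed (fun v => A v /\ B v).
Proof.
move=> [P hP] [Q hQ]; exists (fun p => P p \/ Q p) => v.
rewrite hP hQ; split=> [[h1 h2] p [/h1|/h2]//|h].
by split=> p hp; apply: h; [left|right].
Qed.

Lemma zariski_closed_bigI (I : Type) (A : I -> aset k N) :
  (forall i, zariski_closed (A i)) -> zariski_closed (fun v => forall i, A i v).
Proof.
move=> /choice[P hP]; exists (fun p => exists i, P i p) => v.
split=> [h p [i hi]|h i]; first by move/hP: (h i); apply.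
by apply/hP => p hp; apply: h; exists i.
Qed.

Lemma zariski_closedU A B : zariski_closed A -> zariski_closed B ->
  zariski_closed (fun v => A v \/ B v).
Proof.
move=> [P hP] [Q hQ].
exists (fun p => exists p1 p2, [/\ P p1, Q p2 & p = p1 * p2]) => v.
split=> [h p [p1 [p2 [h1 h2 ->]]]|h].
  rewrite mevalM; case: h => [/hP/(_ _ h1)->|/hQ/(_ _ h2)->]; first by rewrite mul0r.
  by rewrite mulr0.
apply: contrapT => /not_orP[hA hB]; apply: hA; apply/hP => p1 hp1.
apply: contrapT => n1; apply: hB; apply/hQ => p2 hp2.
have /eqP := h _ (ex_intro _ p1 (ex_intro _ p2 (And3 hp1 hp2 erefl))).
by rewrite mevalM mulf_eq0 => /orP[/eqP//|/eqP].
Qed.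

Lemma zariski_closed0 : zariski_closed (fun _ : 'I_N -> k => False).
Proof.
exists (fun _ => True) => v; split=> // /(_ 1 I)/eqP.
by rewrite meval1 oner_eq0.
Qed.

Lemma zariski_closed_preim M (F : ('I_N -> k) -> 'I_M -> k) (A : aset k M) :
  polymap F -> zariski_closed A -> zariski_closed (fun v => A (F v)).
Proof.
move=> hF [P hP]; exists (fun p => exists q, P q /\ forall v, p.@[v] = q.@[F v]) => v.
rewrite hP; split=> [h p [q [hq ->]]|h q hq]; first exact: h.
have [p hp] := polyfun_comp (polyfun_meval q) hF.
by rewrite -hp h //; exists q.
Qed.

(** Intersecting with [Z] turns a mere cover into the equality required by [irreducible_closed]. *)
Lemma irreducible_sub Z A B : irreducible_closed Z ->
  zariski_closed A -> zariski_closed B -> (forall v, Z v -> A v \/ B v) ->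
  subset_of Z A \/ subset_of Z B.
Proof.
move=> [cZ [_ irr]] cA cB h.
have [||v|hA|hB] := irr (fun v => Z v /\ A v) (fun v => Z v /\ B v).
- exact: zariski_closedI.
- exact: zariski_closedI.
- split=> [Zv|[[]|[]]//]; case: (h _ Zv); [left|right]; by split.
- by left=> v /hA[].
- by right=> v /hB[].
Qed.

Lemma irreducible_subU (I : eqType) (s : seq I) (A : I -> aset k N) Z :
  irreducible_closed Z -> (forall i, zariski_closed (A i)) ->
  (forall v, Z v -> exists2 i, i \in s & A i v) ->
  exists2 i, i \in s & subset_of Z (A i).
Proof.
move=> iZ cA; elim: s => [|i s IH] h.
  by have [_ [[v /h[]]]] := iZ.
have cU : zariski_closed (fun v => exists2 i, i \in s & A i v).
  elim: s {IH h} => [|j s IH].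
    suff -> : (fun v => exists2 i, i \in [::] & A i v) = (fun=> False).
      exact: zariski_closed0.
    by apply/funext => v; apply/propext; split=> // -[].
  suff -> : (fun v => exists2 i, i \in j :: s & A i v)
    = (fun v => A j v \/ exists2 i, i \in s & A i v).
    exact: zariski_closedU.
  apply/funext => v; apply/propext; split=> [[l]|[h|[l ls h]]].
  - by rewrite inE => /orP[/eqP->|]; [left|right; exists l].
  - by exists j; rewrite ?mem_head.
  - by exists l; rewrite ?inE ?ls ?orbT.
have [v Zv| |] := irreducible_sub iZ (cA i) cU.
- have [l] := h v Zv; rewrite inE => /orP[/eqP->|]; first by left.
  by right; exists l.
- by exists i; rewrite ?mem_head.
- by move=> /(IH)[l ls hl]; exists l; rewrite ?inE ?ls ?orbT.
Qed.

Lemma irreducible_mulf_eq0 Z (p q : {mpoly k[N]}) : irreducible_closed Z ->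
  (forall v, Z v -> p.@[v] * q.@[v] = 0) ->
  (forall v, Z v -> p.@[v] = 0) \/ (forall v, Z v -> q.@[v] = 0).
Proof.
move=> iZ h; apply: irreducible_sub iZ (zariski_closed_zero p) (zariski_closed_zero q) _.
by move=> v /h/eqP; rewrite mulf_eq0 => /orP[]/eqP; [left|right].
Qed.

End ClosedSets.

Section Chains.
Variables (k : fieldType) (N : nat).
Implicit Types S T : aset k N.

Lemma irr_chain_sub S T d : subset_of S T -> irr_chain S d -> irr_chain T d.
Proof.
move=> sST [Z [h1 h2]]; exists Z; split=> // i hi.
by have [? h] := h1 i hi; split=> // v /h /sST.
Qed.

Lemma irr_chain_leq S d d' : (d' <= d)%N -> irr_chain S d -> irr_chain S d'.
Proof.
move=> le_d [Z [h1 h2]]; exists Z; split=> i hi.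
  exact: h1 (leq_trans hi le_d).
exact: h2 (leq_trans hi le_d).
Qed.

End Chains.

(** * Nonvanishing over an algebraically closed field *)

Section InfiniteField.
Variable k : closedFieldType.

Lemma closed_field_avoid (s : seq k) : exists a, a \notin s.
Proof.
(* The factor for 0 keeps the product nonconstant when [s] is empty, so a root exists; at a point of
   [s] the polynomial takes the value 1. *)
have [|a ha] := closed_rootP (\prod_(x <- 0 :: s) ('X - x%:P) + 1) _.
  rewrite size_polyDl ?size_prod_XsubC //= size_poly1 //.
exists a; apply/negP => as_; move: ha.
rewrite /root hornerD hornerC horner_prod big_cons (big_rem a) //=.
by rewrite !hornerE subrr /= mulr0 mul0r add0r oner_eq0.
Qed.

Lemma closed_field_nonroot (p : {poly k}) : p != 0 -> exists a, p.[a] != 0.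
Proof.
move=> p0; have [s hs] := closed_field_poly_normal p.
have [a ha] := closed_field_avoid s; exists a.
rewrite hs hornerZ mulf_neq0 ?lead_coef_eq0 // horner_prod prodf_seq_neq0.
apply/allP => x xs; rewrite !hornerE subr_eq0; apply: contraNneq ha => ->.
by rewrite xs.
Qed.

Lemma meval_line N (p : {mpoly k[N]}) (x y : 'I_N -> k) :
  exists u : {poly k}, forall t, u.[t] = p.@[fun l => x l + t * (y l - x l)].
Proof.
exists (mmap polyC (fun l => (x l)%:P + 'X * (y l - x l)%:P) p) => t.
rewrite /meval /mmap horner_sum; apply: eq_bigr => m _.
rewrite !hornerE horner_prod; congr (_ * _); apply: eq_bigr => i _.
by rewrite horner_exp !hornerE.
Qed.

(** Polynomials nonzero at [F x] and at [F y] pull back to nonzero one-variable polynomials on the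
    line through [x] and [y]. A parameter where neither vanishes gives a point of the image outside
    both closed sets. *)
Lemma irreducible_image N M (F : ('I_N -> k) -> 'I_M -> k) (Z : aset k M) :
  polymap F -> zariski_closed Z -> (forall v, Z v <-> exists x, F x = v) ->
  irreducible_closed Z.
Proof.
move=> hF cZ hZ; split=> //; split; first by exists (F (fun=> 0)); apply/hZ; exists (fun=> 0).
move=> A B [P hP] [Q hQ] hAB.
apply: contrapT => /not_orP[/existsNP[_ /not_implyP[/hZ[x <-] nA]]].
move=> /existsNP[_ /not_implyP[/hZ[y <-] nB]].
have [p Pp px] : exists2 p, P p & p.@[F x] <> 0.
  by apply: contrapT => /forall2NP h; apply: nA; apply/hP => p Pp; case: (h p) => // /contrapT.
have [q Qq qy] : exists2 q, Q q & q.@[F y] <> 0.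
  by apply: contrapT => /forall2NP h; apply: nB; apply/hQ => q Qq; case: (h q) => // /contrapT.
have [p' hp'] := polyfun_comp (polyfun_meval p) hF.
have [q' hq'] := polyfun_comp (polyfun_meval q) hF.
have [u hu] := meval_line p' x y; have [w hw] := meval_line q' x y.
have u0 : u != 0.
  apply/eqP => u0; move: (hu 0); rewrite u0 horner0 => /esym; rewrite hp'.
  by under eq_fun => l do rewrite mul0r addr0.
have w0 : w != 0.
  apply/eqP => w0; move: (hw 1); rewrite w0 horner0 => /esym; rewrite hq'.
  by under eq_fun => l do rewrite mul1r addrCA subrr addr0.
have [t] := closed_field_nonroot (mulf_neq0 u0 w0).
rewrite hornerM hu hw hp' hq'; set z := F _.
have /hAB[/hP/(_ p Pp)->|/hQ/(_ q Qq)->] : Z z by apply/hZ; eexists.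
  by rewrite mul0r eqxx.
by rewrite mulr0 eqxx.
Qed.

End InfiniteField.

(** * Chains and dimension counts *)

Section SizeBounds.
Variables (R : idomainType) (n : nat).
Implicit Types p q : {mpoly R[n]}.

(** [msize] is the degree plus one, so bounds of the form [_.+1] are degree bounds that also cover
    the zero polynomial. *)
Lemma msizeM_leS p q a b : (msize p <= a.+1)%N -> (msize q <= b.+1)%N ->
  (msize (p * q) <= (a + b).+1)%N.
Proof.
move=> hp hq; have [->|p0] := eqVneq p 0; first by rewrite mul0r msize0.
have [->|q0] := eqVneq q 0; first by rewrite mulr0 msize0.
rewrite msizeM // -subn1 leq_subLR add1n.
by apply: leq_trans (leq_add hp hq) _; rewrite addSn addnS.
Qed.

Lemma msize_prod_leS (I : finType) (P : pred I) (F : I -> {mpoly R[n]}) (a : I -> nat) :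
  (forall i, (msize (F i) <= (a i).+1)%N) ->
  (msize (\prod_(i | P i) F i) <= (\sum_(i | P i) a i).+1)%N.
Proof.
move=> h; apply: (big_rec2 (fun p s => msize p <= s.+1)%N); first by rewrite msize1.
by move=> i s p _; apply: msizeM_leS.
Qed.

Lemma msizeX_leS p a e : (msize p <= a.+1)%N -> (msize (p ^+ e) <= (e * a).+1)%N.
Proof.
by move=> h; elim: e => [|e IH]; [rewrite expr0 msize1 | rewrite exprS mulSn msizeM_leS].
Qed.

End SizeBounds.

Section IndependentProducts.
Variables (k : fieldType) (N : nat).

Definition lin_indep_on (Z : aset k N) (J : finType) (u : J -> {mpoly k[N]}) :=
  forall c : J -> k, (forall v, Z v -> \sum_j c j * (u j).@[v] = 0) ->
    forall j, c j = 0.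

(** The lowest power of [f] in a relation cancels, because the vanishing ideal of [Z'] is prime and
    does not contain [f]. Restriction to [Z] then kills the higher powers and leaves a relation
    between the [u j]. *)
Lemma lin_indep_mulX (Z Z' : aset k N) (J : finType) (u : J -> {mpoly k[N]}) f D :
  irreducible_closed Z' -> subset_of Z Z' -> (forall v, Z v -> f.@[v] = 0) ->
  ~ (forall v, Z' v -> f.@[v] = 0) -> lin_indep_on Z u ->
  lin_indep_on Z' (fun je : (J * 'I_D)%type => u je.1 * f ^+ je.2).
Proof.
move=> iZ' sZZ' f0 nf0 hu c hc.
suff H e (he : (e < D)%N) j : c (j, Ordinal he) = 0.
  by case=> j [e he]; apply: H.
elim/ltn_ind: e he j => e IH he.
(* By induction the coefficients below [e] vanish, so the relation is [f ^+ e] times [q]. *)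
pose q := \sum_(je : J * 'I_D | (e <= je.2)%N) c je *: (u je.1 * f ^+ (je.2 - e)).
have fq : f ^+ e * q = \sum_je c je *: (u je.1 * f ^+ je.2).
  rewrite [RHS](bigID (fun je : J * 'I_D => (e <= je.2)%N)) /= [X in _ + X]big1 ?addr0.
    rewrite mulr_sumr; apply: eq_bigr => je hje.
    by rewrite -scalerAr mulrCA -exprD subnKC.
  by case=> j [e' he'] /=; rewrite -ltnNge => /IH ->; rewrite scale0r.
have fX v : Z' v -> (f ^+ e * q).@[v] = 0.
  move=> /hc <-; rewrite fq raddf_sum; apply: eq_bigr => je _ /=.
  by rewrite mevalZ.
have q0 v : Z' v -> q.@[v] = 0.
  have := @irreducible_mulf_eq0 _ _ _ (f ^+ e) q iZ'.
  case=> [{}v|h|]; [by rewrite -mevalM; apply: fX| |exact].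
  case: nf0 => {}v /h/eqP; rewrite rmorphXn expf_eq0 => /andP[_] /eqP//.
move=> j; apply: (hu (fun j => c (j, Ordinal he))) => v Zv.
rewrite -[RHS](q0 v (sZZ' _ Zv)) /q raddf_sum /=.
transitivity (\sum_j \sum_(e' : 'I_D | (e <= e')%N)
    (c (j, e') *: (u j * f ^+ (e' - e))).@[v]); last first.
  by rewrite pair_big_dep; apply: eq_big => -[].
apply: eq_bigr => j' _; rewrite (bigD1 (Ordinal he)) //= subnn mulr1 mevalZ.
rewrite big1 ?addr0 // => e' /andP[le_ee' ne_ee'].
rewrite mevalZ mevalM rmorphXn /= f0 // expr0n subn_eq0 leqNgt ltn_neqAle.
by rewrite le_ee' eq_sym ne_ee' !mulr0.
Qed.

(** Each strict inclusion supplies a function vanishing on the smaller set but not on the larger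
    one. Its powers below [D] multiply the size of the family by [D] and raise degrees by O(D). *)
Lemma irr_chain_indep (S : aset k N) d : irr_chain S d ->
  exists a, forall D, exists (J : finType) (u : J -> {mpoly k[N]}),
    [/\ #|J| = (D ^ d)%N, forall j, (msize (u j) <= (a * D).+1)%N & lin_indep_on S u].
Proof.
move=> [Z [h1 h2]].
suff [a ha] : exists a, forall D, exists (J : finType) (u : J -> {mpoly k[N]}),
    [/\ #|J| = (D ^ d)%N, forall j, (msize (u j) <= (a * D).+1)%N & lin_indep_on (Z d) u].
  exists a => D; have [J [u [h3 h4 h5]]] := ha D; exists J, u; split=> // c hc.
  by apply: h5 => v Zv; apply: hc; have [_] := h1 d (leqnn d); apply.
elim: d h1 h2 => [|d IH] h1 h2.
  exists 0%N => D; exists unit, (fun=> 1); split=> [|_|c hc []].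
  - by rewrite card_unit.
  - by rewrite msize1.
  have [[_ [[v Zv] _]] _] := h1 0%N isT.
  by have := hc v Zv; rewrite (bigD1 tt) //= big1 => [|[]//]; rewrite meval1 mulr1 addr0.
have [i hi|i hi|a ha] := IH; first by apply: h1; apply: leqW.
  by apply: h2; apply: leqW.
have [sZ nsZ] := h2 d (leqnn _).
have [iZ _] := h1 d (leqnSn _); have [iZ' _] := h1 d.+1 (leqnn _).
have [f f0 nf0] : exists2 f : {mpoly k[N]}, (forall v, Z d v -> f.@[v] = 0)
    & ~ (forall v, Z d.+1 v -> f.@[v] = 0).
  have [[P hP] _] := iZ; apply: contrapT => /forall2NP h; apply: nsZ => v Zv.
  apply/hP => p Pp; have [[]|/contrapT] := h p; last exact.
  by move=> w /hP; apply.
exists (a + msize f)%N => D; have [J [u [h3 h4 h5]]] := ha D.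
exists (J * 'I_D)%type, (fun je : J * 'I_D => u je.1 * f ^+ je.2); split=> [|[j e] /=|].
- by rewrite card_prod h3 card_ord expnSr.
- rewrite mulnDl msizeM_leS // (leq_trans (msizeX_leS e (leqnSn _))) // ltnS.
  by rewrite mulnC leq_mul2l (ltnW (ltn_ord e)) orbT.
- exact: lin_indep_mulX iZ' sZ f0 nf0 h5.
Qed.

End IndependentProducts.

(** * Growth of polynomial functions integral over d functions *)

Section IntegralCoordinates.
Variables (k : fieldType) (N d : nat).
Implicit Types (S : aset k N) (g : ('I_N -> k) -> 'I_d -> k).

Definition integral_on S g (f : ('I_N -> k) -> k) :=
  exists2 P : {poly {mpoly k[d]}}, P \is monic &
    forall v, S v -> root (map_poly (meval (g v)) P) (f v).

Lemma integral_on_polyfun S g (f : ('I_N -> k) -> k) (p : {mpoly k[d]}) :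
  (forall v, S v -> f v = p.@[g v]) -> integral_on S g f.
Proof.
move=> h; exists ('X - p%:P) => [|v Sv]; first exact: monicXsubC.
by rewrite map_polyXsubC root_XsubC h.
Qed.

(** Powers of a root are reduced by division by a monic polynomial. Each multiplication by X adds at
    most [e] to the degrees of the coefficients, so these grow linearly in the exponent. *)
Lemma monic_power_reduction (P : {poly {mpoly k[d]}}) : P \is monic ->
  exists M e, forall a, exists R : {poly {mpoly k[d]}},
    [/\ (size R <= M)%N, forall i, (msize R`_i <= (a * e).+1)%N &
        forall y x, root (map_poly (meval y) P) x -> x ^+ a = (map_poly (meval y) R).[x]].
Proof.
(* The extra factor X gives [Q] positive degree, so that 1, the zeroth power, is already reduced
   even for [P = 1]. *)
move=> mP; pose Q := 'X * P; have mQ : Q \is monic by rewrite monicMl ?monicX.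
have sQ : size Q = (size P).+1 by rewrite /Q mulrC size_mulX ?monic_neq0.
have P1 : (0 < size P)%N by rewrite size_poly_gt0 monic_neq0.
pose e := (\max_(i < size Q) msize Q`_i)%N.
have he i : (msize Q`_i <= e.+1)%N.
  have [hi|hi] := ltnP i (size Q); last by rewrite nth_default ?msize0.
  by apply: leqW; rewrite /e (leq_bigmax (Ordinal hi)).
exists (size P), e; elim=> [|a [R [h1 h2 h3]]].
  exists 1; split=> [|i|y x _]; first by rewrite size_poly1.
    by rewrite coef1; case: (i == _); rewrite ?msize1 ?msize0.
  by rewrite rmorph1 hornerC.
exists ('X * R - (R`_(size P).-1)%:P * Q); split=> [|i|y x hx].
- apply/leq_sizeP => i hi; rewrite coefB coefXM coefCM.
  case: i hi => [|i] hi; first by rewrite leqNgt P1 in hi.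
  rewrite /=.
  case: (ltngtP (size P).-1 i) => [lt|gt|eq].
  + rewrite nth_default ?(leq_trans h1) -1?(prednK P1) //.
    by rewrite (_ : Q`_i.+1 = 0) ?mulr0 ?subr0 // nth_default // sQ ltnS -(prednK P1).
  + by rewrite -ltnS prednK // ltnNge hi in gt.
  + rewrite -eq (prednK P1) (_ : Q`_(size P) = 1) ?mulr1 ?subrr //.
    by move/monicP: mQ; rewrite lead_coefE sQ.
- rewrite coefB coefXM coefCM mulSn addnC.
  apply: leq_trans (msizeD_le _ _) _; rewrite geq_max msizeN.
  rewrite msizeM_leS // andbT; case: (i == 0%N); first by rewrite msize0.
  by apply: leq_trans (h2 _) _; rewrite ltnS leq_addr.
- rewrite exprS (h3 y x hx) rmorphB !rmorphM /= map_polyX map_polyC.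
  by rewrite hornerD hornerN !hornerM hornerX (rootP hx) !mulr0 subr0.
Qed.

Lemma card_bmultinom_le n b : (#|{: 'X_{1..n < b}}| <= b ^ n)%N.
Proof.
rewrite -[X in (_ <= _ ^ X)%N]card_ord -[X in (_ <= X ^ _)%N]card_ord -card_ffun.
have H (m : 'X_{1..n < b}) i : ((m : 'X_{1..n}) i < b)%N.
  by apply: leq_ltn_trans (bmdeg m); rewrite mdegE (bigD1 i) //= leq_addr.
apply: (@leq_card _ _ (fun m : 'X_{1..n < b} => [ffun i => Ordinal (H m i)])).
move=> m1 m2 /ffunP h; apply/val_inj/mnmP => i; move/(congr1 val): (h i).
by rewrite !ffunE.
Qed.

(** After reduction of every coordinate power, a polynomial of degree at most [D] is a combination
    of products of a monomial in the coordinates with exponents below M and a monomial in [g] of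
    degree at most [D * e]. *)
Lemma integral_growth S g : (forall c : 'I_N, integral_on S g (fun v => v c)) ->
  exists C e, forall D, exists (J : finType) (w : J -> ('I_N -> k) -> k),
    (#|J| <= C * (D * e).+1 ^ d)%N /\
    forall p : {mpoly k[N]}, (msize p <= D.+1)%N ->
      exists c : J -> k, forall v, S v -> p.@[v] = \sum_j c j * w j v.
Proof.
move=> hint.
have [P mP hP] : exists2 P : {poly {mpoly k[d]}}, P \is monic &
    forall v c, S v -> root (map_poly (meval (g v)) P) (v c).
  have /choice[P hP] (c : 'I_N) : exists P : {poly {mpoly k[d]}}, P \is monic /\
      forall v, S v -> root (map_poly (meval (g v)) P) (v c).
    by have [P h1 h2] := hint c; exists P.
  (* The product of the equations of all coordinates is a single equation valid for each of them. *)
  exists (\prod_c P c) => [|v c Sv].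
    by apply: monic_prod => c _; have [] := hP c.
  rewrite (bigD1 c) //= rmorphM rootM; apply/orP; left.
  by have [_] := hP c; apply.
have [M [e /choice[R hR]]] := monic_power_reduction mP.
exists (M ^ N)%N, e => D.
exists ('X_{1..d < (D * e).+1} * {ffun 'I_N -> 'I_M})%type.
exists (fun (j : 'X_{1..d < (D * e).+1} * {ffun 'I_N -> 'I_M}) v =>
  (\prod_i g v i ^+ (j.1 : 'X_{1..d}) i) * \prod_c v c ^+ j.2 c).
split; first by rewrite card_prod card_ffun !card_ord mulnC leq_mul2l card_bmultinom_le orbT.
move=> p hp.
pose A (m : 'X_{1..N}) (b : {ffun 'I_N -> 'I_M}) := \prod_c (R (m c))`_(b c).
exists (fun j : 'X_{1..d < (D * e).+1} * {ffun 'I_N -> 'I_M} => \sum_(m : 'X_{1..N < D.+1}) p@_m * (A m j.2)@_(j.1 : 'X_{1..d})).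
move=> v Sv.
have hm (m : 'X_{1..N < D.+1}) : ('X_[m] : {mpoly k[N]}).@[v] =
    \sum_(j : 'X_{1..d < (D * e).+1} * {ffun 'I_N -> 'I_M}) (A m j.2)@_(j.1 : 'X_{1..d}) *
     ((\prod_i g v i ^+ (j.1 : 'X_{1..d}) i) * \prod_c v c ^+ j.2 c).
  rewrite mevalX.
  have -> : \prod_c v c ^+ (m : 'X_{1..N}) c = \prod_c \sum_(i < M) ((R ((m : 'X_{1..N}) c))`_i).@[g v] * v c ^+ i.
    apply: eq_bigr => c _; have [h1 _ h3] := hR ((m : 'X_{1..N}) c).
    rewrite (h3 (g v)) ?hP // (horner_coef_wide _ (n := M)).
      by apply: eq_bigr => i _; rewrite coef_map.
    exact: leq_trans (size_poly _ _) h1.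
  rewrite bigA_distr_bigA /=.
  transitivity (\sum_b \sum_(be : 'X_{1..d < (D * e).+1}) (A m b)@_(be : 'X_{1..d}) *
     ((\prod_i g v i ^+ (be : 'X_{1..d}) i) * \prod_c v c ^+ b c)); last first.
    by rewrite exchange_big pair_big /=.
  apply: eq_bigr => b _; rewrite big_split /= -rmorph_prod -/(A m b).
  have /mpolywE {1}-> : (msize (A m b) <= (D * e).+1)%N.
    have hA c : (msize (R ((m : 'X_{1..N}) c))`_(b c) <= ((m : 'X_{1..N}) c * e).+1)%N.
      by have [_ h _] := hR ((m : 'X_{1..N}) c).
    apply: leq_trans (msize_prod_leS predT hA) _.
    by rewrite ltnS -big_distrl /= -mdegE leq_mul2r -ltnS bmdeg orbT.
  rewrite rmorph_sum mulr_suml; apply: eq_bigr => be _ /=.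
  by rewrite mevalZ mevalX mulrA.
rewrite {1}(mpolywE hp) rmorph_sum /=.
under [RHS]eq_bigr => j _ do rewrite mulr_suml.
rewrite exchange_big; apply: eq_bigr => m _; rewrite mevalZ hm mulr_sumr.
by apply: eq_bigr => j _; rewrite !mulrA.
Qed.

Lemma integral_no_chain S g : (forall c : 'I_N, integral_on S g (fun v => v c)) ->
  ~ irr_chain S d.+1.
Proof.
move=> /integral_growth[C [e hC]] /irr_chain_indep[a ha].
(* This [D] makes the spanning family, of size at most [C * (a * D * e).+1 ^ d], smaller than the
   [D ^ d.+1] independent functions. *)
pose D := (C * (a * e).+1 ^ d).+1.
have [J [u [cJ su iu]]] := ha D; have [J' [w [cJ' hw]]] := hC (a * D)%N.
have {cJ'} lt_J : (#|J'| < #|J|)%N.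
  rewrite cJ; apply: leq_ltn_trans cJ' _.
  have h : ((a * D * e).+1 ^ d <= ((a * e).+1 * D) ^ d)%N.
    have [->//|d0] := posnP d.
    by rewrite leq_exp2r // mulSn mulnAC addnC -addn1 leq_add2l.
  apply: leq_ltn_trans (leq_mul (leqnn C) h) _.
  by rewrite expnMn mulnA expnS ltn_mul2r expn_gt0 /= ltnSn.
have /choice[c hc] j : exists c : J' -> k,
    forall v, S v -> (u j).@[v] = \sum_j' c j' * w j' v by apply: hw.
pose A : 'M[k]_(#|J|, #|J'|) := \matrix_(i, i') c (enum_val i) (enum_val i').
have : kermx A != 0.
  rewrite kermx_eq0 /row_free neq_ltn; apply/orP; left.
  exact: leq_ltn_trans (rank_leq_col A) lt_J.
case/rowV0Pn => z /sub_kermxP zA /eqP; apply.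
apply/rowP => i; rewrite mxE.
have := iu (fun j => z 0 (enum_rank j)) _ (enum_val i); rewrite enum_valK; apply.
move=> v Sv; under eq_bigr => j _ do rewrite hc // mulr_sumr.
rewrite exchange_big big1 //= => j' _.
transitivity ((z *m A) 0 (enum_rank j') * w j' v); last by rewrite zA mxE mul0r.
rewrite mxE mulr_suml.
rewrite (reindex_onto enum_val enum_rank) /=; last by move=> ? _; rewrite enum_rankK.
apply: eq_big => [i'|i' _]; first by rewrite enum_valK eqxx.
by rewrite !mxE enum_valK enum_rankK mulrA.
Qed.

End IntegralCoordinates.

(** * Lifting chains through the symmetrization of a row *)

Section SubstitutionInMmap.
Variables (R S : comNzRingType) (n m : nat) (f : {rmorphism R -> S}).

Lemma mmap_mmap (h : 'I_m -> S) (q : 'I_n -> {mpoly R[m]}) p :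
  mmap f h (mmap (@mpolyC m R) q p) = mmap f (fun i => mmap f h (q i)) p.
Proof.
rewrite {2}/mmap raddf_sum /= [RHS]/mmap; apply: eq_bigr => mm _.
rewrite rmorphM /= mmapC rmorph_prod /=; congr (_ * _).
by apply: eq_bigr => i _; rewrite rmorphXn.
Qed.

Lemma eq_mmap (h h' : 'I_n -> S) p : h =1 h' -> mmap f h p = mmap f h' p.
Proof. by move=> /funext ->. Qed.

Lemma mmap_mesym (h : 'I_n -> S) j : mmap f h (mesym n R j) = (mesym n S j).@[h].
Proof.
rewrite /meval !raddf_sum /=; apply: eq_bigr => s _.
by rewrite !rmorph_prod; apply: eq_bigr => i _ /=; rewrite !mmapX.
Qed.

End SubstitutionInMmap.

Lemma mmap_msym (R S : comNzRingType) n (f : {rmorphism R -> S}) (h : 'I_n -> S)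
  (s : 'S_n) p : mmap f h (msym s p) = mmap f (h \o s) p.
Proof. by rewrite /msym mmap_mmap; apply: eq_mmap => i /=; rewrite mmapX mmap1U. Qed.

(** * Elementary symmetric functions of one row *)

Section ElementarySymmetricMap.
Variables (k : closedFieldType) (n : nat).
Implicit Types y z : 'I_n -> k.

(** Indices start at 0, so the coordinates [c < r] are the elementary symmetric functions of degrees
    1 to r. *)
Definition esymv y : 'I_n -> k := fun c => (mesym n k c.+1).@[y].

Lemma polymap_esymv : polymap esymv.
Proof. by move=> c; apply: polyfun_meval. Qed.

Definition rootpoly y : {poly k} := \prod_c ('X - (y c)%:P).

Lemma coef_rootpoly y (j : 'I_n.+1) :
  (rootpoly y)`_(n - j) = (-1) ^+ j * (mesym n k j).@[y].
Proof.
rewrite -(@meval_eq _ _ (tnth [tuple y c | c < n])); last first.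
  by move=> c; rewrite tnth_mktuple.
rewrite -mroots_coeff big_tuple /rootpoly.
by under [in RHS]eq_bigr => c _ do rewrite tnth_mktuple.
Qed.

Lemma size_rootpoly y : size (rootpoly y) = n.+1.
Proof. by rewrite size_prod_XsubC /index_enum -enumT size_enum_ord. Qed.

Lemma monic_rootpoly y : rootpoly y \is monic.
Proof. exact: monic_prod_XsubC. Qed.

Lemma esymv_rootpoly y z : esymv y = esymv z -> rootpoly y = rootpoly z.
Proof.
move=> eq_yz; apply/polyP => i.
have [hi|hi] := ltnP n i; first by rewrite !nth_default ?size_rootpoly.
have [j ->] : exists j : 'I_n.+1, i = (n - j)%N.
  have hj : (n - i < n.+1)%N by rewrite ltnS leq_subr.
  by exists (Ordinal hj); rewrite /= subKn.
rewrite !coef_rootpoly; congr (_ * _).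
case: j => -[|j] h; first by rewrite mesym0E !meval1.
exact: (congr1 (fun f => f (Ordinal (h : j < n)%N)) eq_yz).
Qed.

(** Equal elementary symmetric functions give the same monic polynomial, hence the same multiset of
    roots. *)
Lemma esymv_perm y z : esymv y = esymv z -> exists s : 'S_n, z = y \o s.
Proof.
move=> /esymv_rootpoly; rewrite /rootpoly => h.
have : \prod_(x <- [tuple z c | c < n]) ('X - x%:P) = \prod_(x <- [tuple y c | c < n]) ('X - x%:P).
  rewrite !big_tuple; under eq_bigr => c _ do rewrite tnth_mktuple.
  by rewrite -h; apply: eq_bigr => c _; rewrite tnth_mktuple.
move=> /prod_XsubC_eq/tuple_permP[s hs]; exists s; apply/funext => c.
have /(congr1 (fun t : n.-tuple k => tnth t c)) := val_inj hs.
by rewrite !tnth_mktuple.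
Qed.

Lemma esymv_permE y (s : 'S_n) : esymv (y \o s) = esymv y.
Proof.
apply/funext => c; rewrite /esymv -[in RHS](issymP _ (mesym_sym n k c.+1) s).
by rewrite /meval mmap_msym.
Qed.

Lemma esymv_surj y : exists z, esymv z = y.
Proof.
(* The preimage consists of the roots of this polynomial. The default 0 is never reached, since
   [(n - i).-1 < n] for [i < n]. *)
pose Q := 'X^n + \poly_(i < n) ((-1) ^+ (n - i) * (if insub (n - i).-1 is Some c then y c else 0)).
have sQ : size Q = n.+1 by rewrite size_polyDl ?size_polyXn // ltnS size_poly.
have mQ : lead_coef Q = 1 by rewrite lead_coefDl ?lead_coefXn // size_polyXn ltnS size_poly.
have [s hs] := closed_field_poly_normal Q; rewrite mQ scale1r in hs.
have ss : size s == n by move: sQ; rewrite hs size_prod_XsubC => -[->].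
exists (tnth (Tuple ss)); apply/funext => c; rewrite /esymv.
have lc : (c.+1 < n.+1)%N by rewrite ltnS.
have := mroots_coeff (Tuple ss) (Ordinal lc); rewrite -hs /=.
rewrite coefD coefXn coef_poly !ltn_subrL /= (leq_trans _ (ltn_ord c)) //.
rewrite eqn_leq leq_subr leqNgt ltn_subrL /= (leq_trans _ (ltn_ord c)) // add0r.
rewrite subKn // (_ : insub _ = Some c) => [h|]; last first.
  by rewrite -[RHS]valK.
by apply: (mulfI (_ : (-1) ^+ c.+1 != 0)); rewrite ?signr_eq0.
Qed.

End ElementarySymmetricMap.

(** * Symmetrization of one row inside a point *)

Section RowSymmetrization.
Variables (k : closedFieldType) (n N : nat) (r : 'I_n -> 'I_N).
Hypothesis r_inj : injective r.
Implicit Types (x : 'I_N -> k) (y : 'I_n -> k).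

Definition upd (T : Type) (x : 'I_N -> T) (y : 'I_n -> T) : 'I_N -> T :=
  fun l => if [pick c | r c == l] is Some c then y c else x l.

Lemma upd_in T (x : 'I_N -> T) (y : 'I_n -> T) c : upd x y (r c) = y c.
Proof.
by rewrite /upd; case: pickP => [c' /eqP/r_inj->//|/(_ c)]; rewrite eqxx.
Qed.

Lemma upd_out T (x : 'I_N -> T) (y : 'I_n -> T) l : (forall c, r c != l) -> upd x y l = x l.
Proof. by rewrite /upd => h; case: pickP => // c; rewrite (negPf (h c)). Qed.

Lemma upd_upd T (x : 'I_N -> T) (y y' : 'I_n -> T) : upd (upd x y) y' = upd x y'.
Proof. by apply/funext => l; rewrite /upd; case: pickP. Qed.

Lemma upd_self T (x : 'I_N -> T) : upd x (x \o r) = x.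
Proof. by apply/funext => l; rewrite /upd; case: pickP => // c /eqP <-. Qed.

Definition rowsym x := upd x (esymv (x \o r)).

Lemma polymap_rowsym : polymap rowsym.
Proof.
move=> l; rewrite /rowsym /upd; case: pickP => [c _|_]; last exact: polyfun_coord.
apply: (polyfun_comp (@polymap_esymv k n c)) => j; exact: polyfun_coord.
Qed.

Lemma rowsym_surj b : exists x, rowsym x = b.
Proof.
have [z hz] := esymv_surj (b \o r); exists (upd b z).
rewrite /rowsym upd_upd -[RHS]upd_self -hz; congr (upd b (esymv _)).
by apply/funext => c; rewrite /= upd_in.
Qed.

Definition rowperm (s : 'S_n) x := upd x (x \o r \o s).

Lemma rowsym_perm s x : rowsym (rowperm s x) = rowsym x.
Proof.
rewrite /rowsym /rowperm upd_upd -(esymv_permE (x \o r) s); congr (upd x (esymv _)).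
by apply/funext => c; rewrite /= upd_in.
Qed.

Lemma rowsym_fiber x x' : rowsym x = rowsym x' -> exists s, x' = rowperm s x.
Proof.
move=> eqx; have /esymv_perm[s hs] : esymv (x \o r) = esymv (x' \o r).
  by apply/funext => c; move/(congr1 (fun f => f (r c))): eqx; rewrite /rowsym !upd_in.
exists s; rewrite /rowperm -hs -[LHS]upd_self.
apply/funext => l; have := congr1 (fun f => f l) eqx.
by rewrite /rowsym /upd; case: pickP.
Qed.

(* In the fundamental theorem over {mpoly k[N]} the variables of the coefficients
   and of the row are independent, so the former can be set to [rowsym x]. *)
Lemma rowsym_norm (p : {mpoly k[N]}) : exists F : {mpoly k[N]}, forall x,
  F.@[rowsym x] = \prod_(s : 'S_n) p.@[rowperm s x].
Proof.
pose P : {mpoly {mpoly k[N]}[n]} := mmap (fun a => a%:MP%:MP)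
  (upd (fun l => ('X_l)%:MP) (fun c => 'X_c)) p.
have evP x y : mmap (meval x) y P = p.@[upd x y].
  rewrite /P [X in mmap _ _ X]/mmap raddf_sum /= [RHS]mevalE; apply: eq_bigr => m _.
  rewrite rmorphM /= mmapC /= mevalC rmorph_prod; congr (_ * _).
  apply: eq_bigr => l _; rewrite rmorphXn /=; congr (_ ^+ _).
  by rewrite /upd; case: pickP => [c _|_]; rewrite ?mmapX ?mmap1U // mmapC /= mevalXU.
pose Q := \prod_(s : 'S_n) msym s P.
have sQ : Q \is symmetric.
  apply/issymP => s; rewrite /Q rmorph_prod /= [RHS](reindex_inj (mulIg s)) /=.
  by apply: eq_bigr => t _; rewrite msymMm.
have [T [hT _]] := sym_fundamental sQ.
exists (mmap idfun (fun c => 'X_(r c)) T) => x.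
have hQ x' y : mmap (meval x') (esymv y) T = \prod_(s : 'S_n) p.@[upd x' (y \o s)].
  transitivity (mmap (meval x') y Q).
    rewrite -hT /comp_mpoly mmap_mmap; apply: eq_mmap => c.
    by rewrite tnth_mktuple mmap_mesym.
  by rewrite /Q rmorph_prod; apply: eq_bigr => s _ /=; rewrite mmap_msym evP.
transitivity (mmap (meval (rowsym x)) (esymv (x \o r)) T).
  rewrite [LHS]raddf_sum; apply: eq_bigr => m _ /=.
  rewrite rmorphM rmorph_prod; congr (_ * _); apply: eq_bigr => c _ /=.
  by rewrite rmorphXn /= mevalXU /rowsym upd_in.
by rewrite hQ; apply: eq_bigr => s _; rewrite /rowsym upd_upd.
Qed.

(** As in prime avoidance, a multiple of an equation [q] nonzero at the new point is added to [p];
    the scalar avoids the finitely many values that would create a zero. *)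
Lemma closed_avoid_finite (A : aset k N) (I : eqType) (s : seq I) (x : I -> 'I_N -> k) :
  zariski_closed A -> (forall i, i \in s -> ~ A (x i)) ->
  exists p : {mpoly k[N]}, (forall v, A v -> p.@[v] = 0) /\
    forall i, i \in s -> p.@[x i] != 0.
Proof.
move=> [P hP]; elim: s => [|i s IH] h; first by exists 0; split=> // v _; rewrite meval0.
have [j js|p [p0 pn]] := IH; first by apply: h; rewrite inE js orbT.
have [q Pq qi] : exists2 q, P q & q.@[x i] != 0.
  apply: contrapT => /forall2NP hq; apply: (h i); rewrite ?mem_head //.
  by apply/hP => q Pq; apply/eqP; have [//|/negP/negPn] := hq q.
have [a ha] := closed_field_avoid [seq - p.@[x j] / q.@[x j] | j <- i :: s].
exists (p + a *: q); split=> [v Av|j js].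
  by move/hP: (Av) => /(_ _ Pq) q0; rewrite mevalD mevalZ q0 p0 // mulr0 addr0.
rewrite mevalD mevalZ; have [q0|q0] := eqVneq q.@[x j] 0.
  rewrite q0 mulr0 addr0 pn //; move: js; rewrite inE => /orP[/eqP ji|//].
  by rewrite -ji q0 eqxx in qi.
apply: contraNneq ha => h0; apply/mapP; exists j => //.
by apply: (mulIf q0); rewrite divfK //; apply/eqP; rewrite -addr_eq0 addrC h0.
Qed.

(** The equations are those whose pullback vanishes on [A]. If [b] is not in the image, some [p]
    vanishing on [A] is nonzero at the finitely many points over [b], and its norm, given by
    [rowsym_norm], separates [b] from the image. *)
Lemma rowsym_closed A : zariski_closed A ->
  zariski_closed (fun b => exists2 x, A x & rowsym x = b).
Proof.
move=> cA; exists (fun F => forall x, A x -> F.@[rowsym x] = 0) => b.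
split=> [[x Ax <-] F|h]; first exact.
have [x hx] := rowsym_surj b; apply: contrapT => nA.
have [|p [p0 pn]] := @closed_avoid_finite A _ (enum 'S_n) (fun s => rowperm s x) cA.
  by move=> s _ As; apply: nA; exists (rowperm s x); rewrite ?rowsym_perm.
have [F hF] := rowsym_norm p.
have /eqP : F.@[b] = 0.
  apply: h => z Az; rewrite hF (bigD1 (1%g : 'S_n)) //= p0 ?mul0r //.
  rewrite /rowperm (_ : _ \o _ = z \o r) ?upd_self //.
  by apply/funext => c; rewrite /= perm1.
rewrite -hx hF; apply/negP/prodf_neq0 => s _; apply: pn; exact: mem_enum.
Qed.

(** Zorn's lemma applies because fibres are finite: if every point over [b] were missed by some
    member of a totally ordered family, the smallest of these members would miss the whole fibre. *)
Lemma rowsym_minimal (C Z : aset k N) :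
  zariski_closed C -> (forall b, Z b -> exists2 x, C x & rowsym x = b) ->
  exists W, [/\ zariski_closed W, subset_of W C,
    forall b, Z b -> exists2 x, W x & rowsym x = b &
    forall W', zariski_closed W' -> subset_of W' W ->
      (forall b, Z b -> exists2 x, W' x & rowsym x = b) -> subset_of W W'].
Proof.
move=> cC sC.
pose ok W := [/\ zariski_closed W, subset_of W C &
  forall b, Z b -> exists2 x, W x & rowsym x = b].
pose T := {W : aset k N | ok W}.
(* The order is reverse inclusion, so a maximal element is a minimal closed set. *)
pose R (W W' : T) := `[< subset_of (sval W') (sval W) >].
have okC : ok C by split.
have [|||[W [cW sW hW]] hmax] := @classical_sets.ZL_preorder T (exist ok C okC) R.
- by move=> W; apply/asboolP.
- by move=> A B D /asboolP h1 /asboolP h2; apply/asboolP => v /h2/h1.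
- move=> A tA; have [[W0 AW0]|nA] := EM (exists W, A W); last first.
    by exists (exist ok C okC) => W AW; case: nA; exists W.
  have okI : ok (fun v => forall W : {W | A W}, sval (sval W) v).
    split=> [|v|b Zb].
    - by apply: zariski_closed_bigI => -[[W [? ?]] ?].
    - by move=> /(_ (exist _ _ AW0)); case: W0 AW0 => W [? sW ?] ?; apply: sW.
    have [x hx] := rowsym_surj b; apply: contrapT => nx.
    have bad s : exists W : T, A W /\ ~ sval W (rowperm s x).
      apply: contrapT => hs; apply: nx; exists (rowperm s x); last by rewrite rowsym_perm.
      by case=> W AW /=; apply: contrapT => nW; apply: hs; exists W.
    have [W [AW hW]] : exists W : T, A W /\ forall s, s \in enum 'S_n -> ~ sval W (rowperm s x).
      elim: (enum 'S_n) => [|s l [W [AW hW]]]; first by exists W0.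
      have [W' [AW' hW']] := bad s.
      have [/asboolP h|/asboolP h] := tA _ _ AW AW'.
        exists W'; split=> // t; rewrite inE => /orP[/eqP->//|tl /h]; exact: hW.
      exists W; split=> // t; rewrite inE => /orP[/eqP->/h//|]; exact: hW.
    case: W AW hW => W [cW sW eW] AW /= hW; have [x' Wx' hx'] := eW b Zb.
    have [|s hs] := @rowsym_fiber x x'; first by rewrite hx hx'.
    by apply: (hW s); rewrite ?mem_enum // -hs.
  exists (exist ok _ okI) => W AW; apply/asboolP => v /= h.
  exact: (h (exist _ W AW)).
exists W; split=> // W' cW' sW' hW'.
have okW' : ok W' by split=> // v /sW'/sW.
have /(hmax (exist ok W' okW')) : R (exist ok W (And3 cW sW hW)) (exist ok W' okW').
  exact/asboolP.
by move/asboolP.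
Qed.

(** If [W] is the union of [A] and [B], their closed images cover [Z]. One image contains [Z], and
    minimality puts [W] in the corresponding piece. *)
Lemma rowsym_minimal_irreducible (W Z : aset k N) :
  irreducible_closed Z -> zariski_closed W ->
  (forall b, Z b -> exists2 x, W x & rowsym x = b) ->
  (forall W', zariski_closed W' -> subset_of W' W ->
      (forall b, Z b -> exists2 x, W' x & rowsym x = b) -> subset_of W W') ->
  irreducible_closed W.
Proof.
move=> iZ cW hW hmin; have [_ [[b Zb] _]] := iZ.
split=> //; split; first by have [x] := hW b Zb; exists x.
move=> A B cA cB hAB.
have [v /hW[x /hAB[Ax|Bx] <-]|hA|hB] :=
  irreducible_sub iZ (rowsym_closed cA) (rowsym_closed cB).
- by left; exists x.
- by right; exists x.
- by left; apply: hmin => // v Av; apply/hAB; left.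
- by right; apply: hmin => // v Bv; apply/hAB; right.
Qed.

(** The chain is lifted from its top, each set inside the lift of the next larger one; strictness is
    inherited from the images. *)
Lemma irr_chain_rowsym (Y : aset k N) d :
  irr_chain Y d -> irr_chain (fun x => Y (rowsym x)) d.
Proof.
move=> [Z [h1 h2]].
suff [W [w1 w2 _]] : exists W : nat -> aset k N, [/\
    forall i, (i <= d)%N -> irreducible_closed (W i) /\
      forall b, Z i b <-> exists2 x, W i x & rowsym x = b,
    forall i, (i < d)%N -> subset_of (W i) (W i.+1) & subset_of (W d) (fun=> True)].
  exists W; split=> i hi.
    have [iW hW] := w1 i hi; split=> // x Wx; have [_] := h1 i hi; apply.
    by apply/hW; exists x.
  have [sZ nsZ] := h2 i hi; split; first exact: w2.
  move=> sW; apply: nsZ => b; have [_ hW] := w1 i.+1 hi; move=> /hW[x /sW Wx <-].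
  by have [_ hW'] := w1 i (ltnW hi); apply/hW'; exists x.
have cT : zariski_closed (fun _ : 'I_N -> k => True).
  by exists (fun=> False); split.
have hT b : Z d b -> exists2 x, True & rowsym x = b.
  by move=> _; have [x hx] := rowsym_surj b; exists x.
(* The induction generalizes the closed set in which the lift is sought, at first the whole
   space. *)
elim: d (fun _ => True) cT hT h1 h2 => [|d IH] C cC hC h1 h2.
  have [iZ _] := h1 0%N isT.
  have cC' : zariski_closed (fun x => C x /\ Z 0%N (rowsym x)).
    by apply: zariski_closedI => //; apply: zariski_closed_preim polymap_rowsym _; case: iZ.
  have [b Zb|W [cW sW hW hmin]] := @rowsym_minimal _ (Z 0%N) cC'.
    by have [x Cx hx] := hC b Zb; exists x; rewrite ?hx.
  exists (fun=> W); split=> // [i|v /sW[]//]; rewrite leqn0 => /eqP->; split.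
    exact: rowsym_minimal_irreducible iZ cW hW hmin.
  by move=> b; split=> [/hW//|[x /sW[_ Zx] <-]].
have [iZ _] := h1 d.+1 (leqnn _).
have cC' : zariski_closed (fun x => C x /\ Z d.+1 (rowsym x)).
  by apply: zariski_closedI => //; apply: zariski_closed_preim polymap_rowsym _; case: iZ.
have [b Zb|W [cW sW hW hmin]] := @rowsym_minimal _ (Z d.+1) cC'.
  by have [x Cx hx] := hC b Zb; exists x; rewrite ?hx.
have [b Zb|i hi|i hi|V [v1 v2 v3]] := IH _ cW.
- by apply: hW; have [+ _] := h2 d (leqnn _); apply.
- exact: h1 (leqW hi).
- exact: h2 (leqW hi).
exists (fun i => if (i <= d)%N then V i else W); split=> [i|i|].
- move=> hid; have /orP[/eqP->|hi] : (i == d.+1) || (i <= d)%N by rewrite -ltnS -leq_eqVlt.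
    2: by rewrite /= hi; apply: v1.
  rewrite /= ltnn; split; first exact: rowsym_minimal_irreducible iZ cW hW hmin.
  by move=> b; split=> [/hW//|[x /sW[_ Zx] <-]].
- move=> hid; have /orP[/eqP->|hi] : (i == d) || (i < d)%N by rewrite -leq_eqVlt.
    by rewrite /= leqnn ltnn.
  by rewrite /= (ltnW hi) hi; apply: v2.
- by rewrite /= ltnn => v /sW[].
Qed.

End RowSymmetrization.


(** * Integrality over weighted power sums *)

Section WeightedPowerSums.

Definition is_ideal (A : comNzRingType) (J : A -> Prop) :=
  [/\ J 0, forall a b, J a -> J b -> J (a + b) & forall a b, J b -> J (a * b)].

Section Ideals.
Variables (A : comNzRingType) (J : A -> Prop).
Hypothesis iJ : is_ideal J.

Lemma ideal_sum (I : finType) (P : pred I) (F : I -> A) :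
  (forall i, P i -> J (F i)) -> J (\sum_(i | P i) F i).
Proof. by have [h0 hD _] := iJ; move=> h; apply: (big_ind J). Qed.

Lemma ideal_prod_cong (I : finType) (P : pred I) (F G : I -> A) :
  (forall i, P i -> J (F i - G i)) -> J (\prod_(i | P i) F i - \prod_(i | P i) G i).
Proof.
have [h0 hD hM] := iJ; move=> h.
apply: (big_rec2 (fun x y => J (x - y))) => [|i x y Pi hxy]; first by rewrite subrr.
have -> : F i * x - G i * y = F i * (x - y) + y * (F i - G i).
  by rewrite !mulrBr (mulrC y (F i)) (mulrC y (G i)) addrA subrK.
by apply: hD; apply: hM => //; apply: h.
Qed.

End Ideals.

(* Lagrange interpolation with [f = X * prod_(j <> i) (X - w j)], whose
   coefficients pair with the power sums, puts [w i * prod (w i - w j)] in the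
   ideal. Modulo [w i - w j] the two points merge and induction applies. *)
Lemma weighted_power_sums_nilpotent (A : comNzRingType) (n s : nat) (m : 'I_s -> nat)
  (w : 'I_s -> A) (J : A -> Prop) :
  (forall j, (0 < j <= n)%N -> exists u : A, u * j%:R = 1) -> is_ideal J ->
  (forall i, 0 < m i)%N -> (\sum_i m i <= n)%N ->
  (forall t, (0 < t <= s)%N -> J (\sum_i (m i)%:R * w i ^+ t)) ->
  forall i, exists M, J (w i ^+ M).
Proof.
move=> hinv; elim: s m w J => [|s IH] m w J iJ hm sm hq i; first by case: i.
have [J0 JD JM] := iJ.
have /choice[My hMy] (j : 'I_s.+1) : exists My : nat * A,
    j != i -> J (w i ^+ My.1 - (w i - w j) * My.2).
  have [->|nji] := eqVneq j i; first by exists (0%N, 0).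
  pose J' x := exists y, J (x - (w i - w j) * y).
  have iJ' : is_ideal J'.
    split=> [|a b [y hy] [z hz]|a b [y hy]].
    - by exists 0; rewrite mulr0 subr0.
    - by exists (y + z); rewrite mulrDr opprD addrACA; apply: JD.
    - by exists (a * y); rewrite mulrCA -mulrBr; apply: JM.
  have [l0 hl0 _] := unlift_some nji.
  (* Modulo [w i - w j] the point [j] is dropped, and its weight goes to [l0], the index of [i]
     among the remaining points. *)
  pose m' l := (m (lift j l) + (l == l0) * m j)%N.
  have sumE (B : nmodType) (F : 'I_s.+1 -> B) : \sum_l F (lift j l) + F j = \sum_l F l.
    by rewrite [RHS](bigD1_ord j) //= addrC.
  have [M [y hy]] : exists M, J' (w (lift j l0) ^+ M); last first.
    by exists (M, y) => _; rewrite /= {1}hl0.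
  apply: (IH m' (w \o lift j)) => //.
  - by move=> l; rewrite addn_gt0 hm.
  - apply: leq_trans sm; rewrite big_split /= -big_distrl /=.
    rewrite (_ : \sum_l (l == l0) = 1)%N ?mul1n; last first.
      by rewrite (bigD1 l0) //= eqxx big1 // => l /negPf->.
    by rewrite [leqRHS](bigD1_ord j) //= addnC.
  - move=> t /andP[t0 ts].
    have hJ : J (\sum_l (m l)%:R * w l ^+ t) by apply: hq; rewrite t0 leqW.
    exists ((m j)%:R * \sum_(e < t) w i ^+ (t.-1 - e) * w j ^+ e).
    set X := (X in J X); suff -> : X = \sum_l (m l)%:R * w l ^+ t by [].
    rewrite /X [X in _ - X]mulrCA -subrXX {X}.
    rewrite -(sumE _ (fun l => (m l)%:R * w l ^+ t)).
    under eq_bigr => l _ do rewrite /m' /= natrD mulrDl.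
    rewrite big_split /= -addrA; congr (_ + _).
    rewrite (bigD1 l0) //= eqxx mul1n big1 ?addr0 => [|l /negPf->]; last by rewrite mul0r.
    by rewrite -hl0 mulrBr opprB addrC subrK.
pose g := \prod_(j | j != i) ('X - (w j)%:P); pose f := 'X * g.
have Jf : J (f.[w i]).
  have [u hu] : exists u : A, u * (m i)%:R = 1.
    apply: hinv; rewrite hm; apply: leq_trans sm.
    by rewrite [leqRHS](bigD1 i) //= leq_addr.
  rewrite -[f.[_]]mul1r -hu -mulrA; apply: (JM).
  have -> : (m i)%:R * f.[w i] = \sum_l (m l)%:R * f.[w l].
    rewrite (bigD1 i) //= big1 ?addr0 // => l nli.
    by rewrite hornerM horner_prod (bigD1 l) //= !hornerE subrr /= mulr0 mul0r.
  have sf : (size f <= s.+2)%N.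
    rewrite /f mulrC size_mulX ?monic_neq0 ?monic_prod_XsubC // ltnS.
    rewrite /g -big_filter size_prod_XsubC ltnS -sum1_size big_filter sum1_card.
    by rewrite (eq_card (B := predC1 i)) // cardC1 card_ord.
  under eq_bigr => l _ do rewrite (horner_coef_wide _ sf) mulr_sumr.
  rewrite exchange_big; apply: (ideal_sum iJ) => t _ /=.
  under eq_bigr => l _ do rewrite mulrCA.
  rewrite -mulr_sumr; case: t => -[|t] /= ht.
    by rewrite coefXM mul0r.
  by apply: JM; apply: hq.
(* The product of the powers found for each [j], times one more [w i] for the factor X of [f], is
   congruent modulo [J] to a multiple of [f.[w i]]. *)
exists (\sum_(j | j != i) (My j).1).+1.
rewrite exprS -prodrXr.
have := ideal_prod_cong iJ hMy => /(JM (w i)); rewrite mulrBr => h.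
rewrite -[_ * _](subrK (w i * \prod_(j | j != i) ((w i - w j) * (My j).2))).
apply: JD => //; rewrite big_split /= mulrA mulrC; apply: JM.
move: Jf; rewrite hornerM horner_prod hornerX.
by under eq_bigr => j _ do rewrite !hornerE.
Qed.

End WeightedPowerSums.

Lemma pihomogM_dhomog (R : comNzRingType) n (q h : {mpoly R[n]}) d D : q \is d.-homog ->
  pihomog mdeg D (q * h) = if (d <= D)%N then q * pihomog mdeg (D - d) h else 0.
Proof.
move=> hq; pose K := (msize h + D.+1)%N.
rewrite {1}(pihomog_partitionE (mf := mdeg) (k := K) (p := h)) ?leq_addr //.
rewrite mulr_sumr raddf_sum /=.
have hd (e : nat) : q * pihomog mdeg e h \is (d + e).-homog by rewrite dhomogM // pihomogP.
have [dD|dD] := leqP d D; last first.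
  apply: big1 => e _; rewrite (pihomog_ne0 _ (hd e)) // neq_ltn.
  by rewrite (leq_trans dD) ?orbT ?leq_addr.
have lt_K : (D - d < K)%N by rewrite /K addnS ltnS (leq_trans (leq_subr _ _)) ?leq_addl.
rewrite (bigD1 (Ordinal lt_K)) //= big1 ?addr0 => [|e ne].
  by rewrite pihomog_dE //; have := hd (D - d)%N; rewrite subnKC.
rewrite (pihomog_ne0 _ (hd e)) //; apply: contraNneq ne => eD.
by apply/eqP/val_inj; rewrite /= -eD addKn.
Qed.

Section WeightedIntegrality.
Variables (k : fieldType) (n s : nat) (m : 'I_s -> nat).
Hypothesis natr_neq0 : forall j, (0 < j <= n)%N -> (j%:R : k) != 0.
Hypotheses (m_gt0 : forall i, (0 < m i)%N) (sum_m : (\sum_i m i <= n)%N).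

(** These are the first [s] power sums of a row in which the value [w i] occurs [m i] times. *)
Definition wpsum (w : 'I_s -> k) : 'I_s -> k := fun t => \sum_i (m i)%:R * w i ^+ t.+1.

Let q (t : nat) : {mpoly k[s]} := \sum_i (m i)%:R * 'X_i ^+ t.+1.

Let q_homog t : q t \is t.+1.-homog.
Proof.
apply: rpred_sum => i _; rewrite mulr_natl rpredMn //.
by rewrite mpolyXn dhomogX /= mdegMn mdeg1 mul1n.
Qed.

Let q_eval t w : (q t).@[w] = \sum_i (m i)%:R * w i ^+ t.+1.
Proof.
rewrite raddf_sum; apply: eq_bigr => i _ /=.
by rewrite rmorphM rmorph_nat rmorphXn /= mevalXU.
Qed.

(** The nilpotency result is applied to the variables themselves and to the ideal generated by the
    [q t]. Summing the exponents makes M uniform in [i]. *)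
Let power_in_ideal : exists2 M, (0 < M)%N & forall i : 'I_s, exists h : 'I_s -> {mpoly k[s]},
  'X_i ^+ M = \sum_(t < s) q t * h t.
Proof.
pose J (f : {mpoly k[s]}) := exists h : 'I_s -> {mpoly k[s]}, f = \sum_(t < s) q t * h t.
have iJ : is_ideal J.
  split=> [|a b [h ->] [h' ->]|a b [h ->]].
  - by exists (fun=> 0); rewrite big1 // => t _; rewrite mulr0.
  - exists (fun t => h t + h' t); rewrite -big_split.
    by apply: eq_bigr => t _; rewrite mulrDr.
  - exists (fun t => a * h t); rewrite mulr_sumr.
    by apply: eq_bigr => t _; rewrite mulrCA.
have /choice[M hM] i : exists M, J ('X_i ^+ M).
  apply: (@weighted_power_sums_nilpotent _ n s m (fun i => 'X_i) J) => // [j hj|t].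
    exists (j%:R^-1)%:MP; rewrite -mpolyC_nat -mpolyCM mulVf ?natr_neq0 //.
  case: t => // t ht; exists (fun t' => (t' == Ordinal (ht : t < s)%N)%:R).
  rewrite [RHS](bigD1 (Ordinal (ht : t < s)%N)) //= eqxx mulr1 [X in _ = _ + X]big1 ?addr0 // => t' /negPf->.
  by rewrite mulr0.
exists (\sum_i M i).+1 => // i; have [_ _ JM] := iJ.
rewrite (_ : _.+1 = ((\sum_i M i).+1 - M i) + M i)%N.
  by rewrite exprD; apply: JM.
by rewrite subnK // leqW // (bigD1 i) //= leq_addr.
Qed.

(** Only the component of degree M is kept: the cofactor of [q t], which has degree t + 1, then has
    degree M - t - 1 or is zero. Replacing ['X_i ^+ M] thus lowers the degree of what multiplies
    [q t]. *)
Let power_small_coef : exists2 M, (0 < M)%N & forall i : 'I_s, exists2 h : 'I_s -> {mpoly k[s]},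
  'X_i ^+ M = \sum_(t < s) q t * h t & forall t : 'I_s, (msize (h t) <= M - t)%N.
Proof.
have [M M0 hM] := power_in_ideal; exists M => // i; have [h hh] := hM i.
exists (fun t : 'I_s => if (t < M)%N then pihomog mdeg (M - t.+1) (h t) else 0) => [|t].
  rewrite -[LHS](pihomog_dE (mf := mdeg) (d := M)); last first.
    by rewrite mpolyXn dhomogX /= mdegMn mdeg1 mul1n.
  rewrite hh raddf_sum; apply: eq_bigr => t _ /=.
  by rewrite (pihomogM_dhomog _ _ (q_homog t)); case: ifP => // _; rewrite mulr0.
case: ifP => ht; last by rewrite msize0.
rewrite -(subnSK ht); rewrite mmeasureE; apply/bigmax_leqP_seq => /= mm hmm _.
by rewrite (dhomog_mf (pihomogP mdeg (M - t.+1) (h t)) hmm).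
Qed.

(** By induction on the degree, the monomials with exponents below M span all polynomials over the
    weighted power sums. Multiplication by the variable [i] is then a matrix, whose characteristic
    polynomial is the equation. *)
Lemma wpsum_integral i : exists2 P : {poly {mpoly k[s]}}, P \is monic &
  forall w, root (map_poly (meval (wpsum w)) P) (w i).
Proof.
have [M M0 hM] := power_small_coef.
pose mon (b : {ffun 'I_s -> 'I_M}) (w : 'I_s -> k) := \prod_j w j ^+ b j.
pose span (p : {mpoly k[s]}) := exists A : {ffun 'I_s -> 'I_M} -> {mpoly k[s]},
  forall w, p.@[w] = \sum_b (A b).@[wpsum w] * mon b w.
have span0 : span 0.
  by exists (fun=> 0) => w; rewrite meval0 big1 // => b _; rewrite meval0 mul0r.
have spanD p1 p2 : span p1 -> span p2 -> span (p1 + p2).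
  move=> [A hA] [B hB]; exists (fun b => A b + B b) => w.
  by rewrite mevalD hA hB -big_split; apply: eq_bigr => b _; rewrite /= mevalD mulrDl.
have spanZ c p : span p -> span (c *: p).
  move=> [A hA]; exists (fun b => c *: A b) => w.
  by rewrite mevalZ hA mulr_sumr; apply: eq_bigr => b _; rewrite mevalZ mulrA.
have spanq (t : 'I_s) p : span p -> span (q t * p).
  move=> [A hA]; exists (fun b => 'X_t * A b) => w.
  rewrite mevalM hA q_eval mulr_sumr; apply: eq_bigr => b _.
  by rewrite mevalM mevalXU mulrA.
have span_all p : span p.
  have [D] := ubnP (msize p); elim: D p => // D IH p; rewrite ltnS => hp.
  rewrite (mpolyE p) big_seq; apply: (big_ind span) => // mm hmm; apply: spanZ.
  have {hmm} hD : (mdeg mm < D)%N by apply: leq_trans (msize_mdeg_lt hmm) hp.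
  have [hb|] := boolP [forall j, mm j < M]%N.
    pose b0 : {ffun 'I_s -> 'I_M} := [ffun j => Ordinal (forallP hb j)].
    exists (fun b => (b == b0)%:R) => w.
    rewrite (bigD1 b0) //= eqxx meval1 mul1r big1 ?addr0 => [|b /negPf->]; last first.
      by rewrite meval0 mul0r.
    by rewrite mevalX; apply: eq_bigr => j _; rewrite ffunE.
  rewrite negb_forall => /existsP[j]; rewrite -leqNgt => hj.
  have [h Xj sh] := hM j.
  have le_m : (U_(j) *+ M <= mm)%MM.
    apply/mnm_lepP => l; rewrite mulmnE mnm1E; case: eqP => [<-|_]; last by rewrite mul0n.
    by rewrite mul1n.
  have dm : (mdeg (mm - U_(j) *+ M) + M = mdeg mm)%N.
    by rewrite -[in RHS](submK le_m) mdegD mdegMn mdeg1 mul1n.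
  rewrite -(submK le_m) mpolyXD -mpolyXn Xj mulrC mulr_suml.
  apply: (big_ind span) => // t _; rewrite -mulrA; apply/spanq/IH.
  have [ht|ht] := ltnP t M; last first.
    have : (msize (h t) <= 0)%N by rewrite (leq_trans (sh t)) // leqn0 subn_eq0.
    rewrite leqn0 msize_poly_eq0 => /eqP ->; rewrite mul0r msize0.
    exact: leq_ltn_trans hD.
  have hX : (msize ('X_[mm - U_(j) *+ M] : {mpoly k[s]}) <= (mdeg (mm - U_(j) *+ M)).+1)%N.
    by rewrite msizeX.
  have := sh t; rewrite -(subnSK ht) => /msizeM_leS/(_ hX) h1.
  apply: leq_ltn_trans h1 _; apply: leq_ltn_trans hD.
  by rewrite -dm addnC -addnS subnSK // leq_add2l leq_subr.
have /choice[A hA] (b : {ffun 'I_s -> 'I_M}) : exists A : {ffun 'I_s -> 'I_M} -> {mpoly k[s]},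
    forall w, w i * mon b w = \sum_b' (A b').@[wpsum w] * mon b' w.
  have [A hA] := span_all ('X_i * \prod_j 'X_j ^+ b j); exists A => w.
  rewrite -hA mevalM mevalXU rmorph_prod; congr (_ * _).
  by apply: eq_bigr => j _; rewrite rmorphXn /= mevalXU.
pose B : 'M[{mpoly k[s]}]_#|{: {ffun 'I_s -> 'I_M}}| :=
  \matrix_(b', b) A (enum_val b) (enum_val b').
exists (char_poly B) => [|w]; first exact: char_poly_monic.
rewrite map_char_poly -eigenvalue_root_char; apply/eigenvalueP.
exists (\row_b mon (enum_val b) w).
  apply/rowP => b; rewrite !mxE hA [RHS](reindex_onto enum_val enum_rank) /=; last first.
    by move=> ? _; rewrite enum_rankK.
  apply: eq_big => [b'|b' _]; first by rewrite enum_valK eqxx.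
  by rewrite !mxE mulrC.
(* The eigenvector of monomial values is nonzero, because the monomial with zero exponents has value
   1. *)
apply/eqP => /rowP/(_ (enum_rank [ffun=> Ordinal M0])); rewrite !mxE enum_rankK.
rewrite /mon big1 => [/eqP|j _]; first by rewrite oner_eq0.
by rewrite ffunE expr0.
Qed.

End WeightedIntegrality.

(** * Rows of coordinates *)

(** The weighted form of the fundamental theorem writes the power sum of degree [t] through
    elementary symmetric functions of degree at most [t]. *)
Lemma power_sum_esymv (k : closedFieldType) n (y z : 'I_n -> k) r t :
  (forall c : 'I_n, (c < r)%N -> esymv y c = esymv z c) -> (0 < t <= r)%N ->
  \sum_c y c ^+ t = \sum_c z c ^+ t.
Proof.
move=> eq_yz /andP[t0 tr].
pose p : {mpoly k[n]} := \sum_i 'X_i ^+ t.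
have sp : p \is symmetric.
  apply/issymP => s; rewrite /p raddf_sum [RHS](reindex_inj (@perm_inj _ s)) /=.
  by apply: eq_bigr => i _; rewrite /msym rmorphXn /= mmapX mmap1U.
have hp : (msize p <= t.+1)%N.
  apply: leq_trans (msize_sum _ _ _) _; apply/bigmax_leqP => i _.
  by rewrite mpolyXn msizeX mdegMn mdeg1 mul1n.
have [T [hT wT]] := sym_fundamental sp.
have ev x : \sum_c x c ^+ t = T.@[esymv x].
  transitivity p.@[x].
    by rewrite raddf_sum; apply: eq_bigr => c _; rewrite /= rmorphXn /= mevalXU.
  rewrite -hT comp_mpoly_meval; apply: meval_eq => c.
  by rewrite tnth_mktuple.
rewrite !ev !mevalE; apply: eq_big_seq => mm hmm; congr (_ * _).
apply: eq_bigr => c _; have [cr|cr] := ltnP c r; first by rewrite eq_yz.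
(* The variable [c] has weight [c.+1 > t] and cannot occur. *)
suff -> : mm c = 0%N by rewrite !expr0.
apply/eqP; rewrite -leqn0 leqNgt; apply/negP => mc0.
have := leq_trans (mmeasure_mnm_lt mnmwgt hmm) (leq_trans wT hp).
rewrite ltnS leqNgt => /negP; apply; apply: leq_ltn_trans tr _.
have le_c : (mm c * c.+1 <= \sum_i mm i * i.+1)%N by rewrite (bigD1 c) //= leq_addr.
apply: leq_trans le_c; apply: leq_ltn_trans cr _.
exact: leq_pmull.
Qed.

(** * Lower bounds from polynomial retractions *)

Section RetractionChain.
Variables (k : closedFieldType) (N : nat) (E : {set 'I_N}).
Variable tau : ('I_N -> k) -> 'I_N -> k.
Hypotheses (tau_poly : polymap tau)
  (tau_free : forall v l, l \in E -> tau v l = v l)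
  (tau_ext : forall v v', (forall l, l \in E -> v l = v' l) -> tau v = tau v').

(** The fixed set of [tau] is an affine space with coordinates in [E]. The chain consists of the
    images of the subspaces that keep only the first j of these coordinates. *)
Lemma retraction_chain : irr_chain (fun v => tau v = v) #|E|.
Proof.
pose kill j (x : 'I_N -> k) l := if (l \in E) && (index l (enum E) < j)%N then x l else 0.
(* Written as equations, this set is visibly closed; [ZP] identifies it with an image, which makes
   it irreducible. *)
pose Z j (v : 'I_N -> k) := tau v = v /\ forall l, tau v l = tau (kill j v) l.
have ZP j v : Z j v <-> exists x, tau (kill j x) = v.
  split=> [[tv h]|[x <-]]; first by exists v; apply/funext => l; rewrite -h tv.
  have t2 y : tau (tau y) = tau y by apply: tau_ext => l; apply: tau_free.
  rewrite /Z t2; split=> // l; congr (_ l); apply: tau_ext => {}l lE.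
  by rewrite /kill lE /=; case: ifP => // h; rewrite tau_free ?lE // h.
have kill_poly j : polymap (kill j).
  move=> l; rewrite /kill; case: ((l \in E) && (index l (enum E) < j)%N); [exact: polyfun_coord | exact: polyfun_cst].
have Z_closed j : zariski_closed (Z j).
  apply: zariski_closedI; last by apply: zariski_closed_eq => l; [|apply: polymap_comp].
  suff -> : (fun v => tau v = v) = (fun v => forall l, tau v l = v l).
    by apply: zariski_closed_eq => // l; apply: polyfun_coord.
  by apply/funext => v; apply/propext; split=> [-> //|h]; apply/funext.
exists Z; split=> j hj.
  split; last by move=> v [].
  exact: irreducible_image (polymap_comp tau_poly (kill_poly j)) (Z_closed j) (ZP j).
split=> [v /ZP[x <-]|sZ].
  apply/ZP; exists (kill j x); congr tau; apply/funext => l; rewrite /kill.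
  by case: (l \in E) => //=; case: (ltnP _ j) => [h|_]; rewrite ?if_same // ltnS ltnW.
have [l lE hl] : exists2 l, l \in E & index l (enum E) = j.
  have lt_j : (j < size (enum E))%N by rewrite -cardE.
  have [l0 _] : exists l0 : 'I_N, true by case: (enum E) lt_j => // a; exists a.
  exists (nth l0 (enum E) j); first by rewrite -mem_enum mem_nth.
  by rewrite index_uniq ?enum_uniq.
have /sZ[_ /(_ l)] : Z j.+1 (tau (kill j.+1 (fun=> 1))) by apply/ZP; eexists.
rewrite !tau_free // /kill lE hl ltnn ltnSn /= => /eqP.
by rewrite oner_eq0.
Qed.

End RetractionChain.

Section Rows.
Variables (k : closedFieldType) (m n : nat).
Implicit Types (v : 'I_(m * n) -> k) (D : {set 'I_m}).

Definition zrow v (i : 'I_m) : 'I_n -> k := fun c => v (mxvec_index i c).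

Definition idx (l : 'I_(m * n)) : 'I_m * 'I_n := enum_val (cast_ord (esym (mxvec_cast m n)) l).

Definition of_rows (f : 'I_m -> 'I_n -> k) : 'I_(m * n) -> k :=
  fun l => f (idx l).1 (idx l).2.

Lemma mxvec_indexK i c : idx (mxvec_index i c) = (i, c).
Proof. by rewrite /idx /mxvec_index cast_ordK enum_rankK. Qed.

Lemma idxK l : mxvec_index (idx l).1 (idx l).2 = l.
Proof. by case/mxvec_indexP: l => i c; rewrite mxvec_indexK. Qed.

Lemma idx_bij : bijective idx.
Proof. by exists (fun ic => mxvec_index ic.1 ic.2) => [l|[i c]]; rewrite ?idxK ?mxvec_indexK. Qed.

Lemma mxvec_index_inj i : injective (@mxvec_index m n i).
Proof. by move=> c c' /(congr1 idx); rewrite !mxvec_indexK => -[]. Qed.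

Lemma zrow_of_rows f i : zrow (of_rows f) i = f i.
Proof. by apply/funext => c; rewrite /zrow /of_rows mxvec_indexK. Qed.

Lemma of_rowsK v : of_rows (zrow v) = v.
Proof. by apply/funext => l; rewrite /of_rows /zrow idxK. Qed.

Definition symrows D v := of_rows (fun i => if i \in D then esymv (zrow v i) else zrow v i).

Lemma irr_chain_symrows D Y d : irr_chain Y d -> irr_chain (fun v => Y (symrows D v)) d.
Proof.
have -> : symrows D =
    fun v => of_rows (fun i => if i \in enum D then esymv (zrow v i) else zrow v i).
  by apply/funext => v; congr of_rows; apply/funext => i; rewrite mem_enum.
elim: (enum D) (enum_uniq (mem D)) => [_ hY|i s IH /andP[nis us] /(IH us) hY].
  by under [X in irr_chain X]eq_fun => v do rewrite of_rowsK.
have := irr_chain_rowsym (@mxvec_index_inj i) hY; apply: irr_chain_sub => v.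
congr Y; congr of_rows; apply/funext => i'; rewrite inE.
have [->|ne] /= := eqVneq i' i.
  rewrite (negPf nis); apply/funext => c; rewrite /zrow /rowsym upd_in //.
  exact: mxvec_index_inj.
suff -> : zrow (rowsym (mxvec_index i) v) i' = zrow v i' by [].
apply/funext => c; rewrite /zrow /rowsym upd_out // => c'.
apply: contraNneq ne => /(congr1 idx); rewrite !mxvec_indexK => -[-> _] //.
Qed.

Section FreeCoordinates.
Variables (r : nat) (i0 : 'I_m) (D : {set 'I_m}) (rho : 'I_n -> 'I_n).
Hypotheses (i0D : i0 \notin D) (rho_idem : forall c, rho (rho c) = rho c).

(** The parameters left once the rows of [D] are symmetrized: one value per fixed point of [rho] in
    row [i0], and the elementary symmetric functions of degree above [r] in each row of [D]. *)
Definition free_coords : {set 'I_(m * n)} := idx @^-1: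
  (setX [set i0] [set c | rho c == c] :|: setX D [set c : 'I_n | (r <= c)%N]).

Lemma mem_free_coords i c : (mxvec_index i c \in free_coords) =
  (i == i0) && (rho c == c) || (i \in D) && (r <= c)%N.
Proof. by rewrite inE mxvec_indexK !inE. Qed.

Lemma card_free_coords :
  #|free_coords| = (#|[set c | rho c == c]| + #|D| * (n - r))%N.
Proof.
rewrite on_card_preimset; last exact: onW_bij idx_bij.
rewrite cardsU disjoint_setI0 ?cards0 ?subn0.
  rewrite !cardsX cards1 mul1n; congr (_ + _ * _)%N.
  rewrite cardsE -sum1_card; have -> : (n - r = \sum_(r <= c < n) 1)%N by rewrite sum_nat_const_nat muln1.
  by rewrite big_geq_mkord.
rewrite -setI_eq0; apply/eqP/setP => -[i c]; rewrite !inE /=.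
by apply/negbTE/negP => /and3P[/andP[/eqP-> _] h _]; case/negP: i0D.
Qed.

(** The rows of [D] hold elementary symmetric functions here: the first [r] are computed from row
    [i0]. Every row outside [D] becomes row [i0] repeated along [rho]. *)
Definition glue v := of_rows (fun i c =>
  if i \in D then (if (c < r)%N then esymv (zrow v i0 \o rho) c else zrow v i c)
  else zrow v i0 (rho c)).

Lemma glue_chain :
  irr_chain (fun v => glue (symrows D v) = symrows D v) #|free_coords|.
Proof.
apply: (@irr_chain_symrows D (fun v => glue v = v)); apply: retraction_chain.
- move=> l; rewrite /glue /of_rows; case: (_ \in D); last exact: polyfun_coord.
  case: (_ < r)%N; last exact: polyfun_coord.
  apply: (polyfun_comp (@polymap_esymv k n _)) => j; exact: polyfun_coord.
- move=> v l; case/mxvec_indexP: l => i c; rewrite mem_free_coords.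
  rewrite -[glue v _]/(zrow _ _ _) zrow_of_rows => /orP[/andP[/eqP-> /eqP->]|/andP[-> rc]].
    by rewrite (negPf i0D).
  by rewrite ltnNge rc.
- move=> v v' eq_v; congr of_rows; apply/funext => i; apply/funext => c.
  have eq0 c' : zrow v i0 (rho c') = zrow v' i0 (rho c').
    by apply: eq_v; rewrite mem_free_coords eqxx rho_idem eqxx.
  case: ifP => iD //; case: ltnP => rc.
    by congr (esymv _ c); apply/funext => c'; exact: eq0.
  by apply: eq_v; rewrite mem_free_coords iD rc orbT.
Qed.

End FreeCoordinates.
End Rows.

(** * Upper bounds from integrality over the free coordinates *)

Section RowsUpperBound.
Variables (k : closedFieldType) (m n r : nat) (S : aset k (m * n)).
Variables (i0 : 'I_m) (D : {set 'I_m}) (rho : 'I_m -> 'I_n -> 'I_n).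
Hypotheses (natr_neq0 : forall j, (0 < j <= n)%N -> (j%:R : k) != 0)
  (i0D : i0 \notin D)
  (rho_idem : forall c, rho i0 (rho i0 c) = rho i0 c)
  (S_rho : forall v i c, S v -> i \notin D -> zrow v i (rho i c) = zrow v i c)
  (S_esym : forall v i (c : 'I_n), S v -> (c < r)%N ->
     esymv (zrow v i) c = esymv (zrow v i0) c)
  (card_rho : forall i, i \notin D -> i != i0 -> (#|codom (rho i)| <= r)%N).

Let E := free_coords r i0 D (rho i0).
Let g (v : 'I_(m * n) -> k) : 'I_#|E| -> k := fun j => symrows D v (enum_val j).

Let polyg (f : ('I_(m * n) -> k) -> k) :=
  exists A : {mpoly k[#|E|]}, forall v, S v -> f v = A.@[g v].

Let polyg_free l : l \in E -> polyg (fun v => symrows D v l).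
Proof.
by move=> lE; exists 'X_(enum_rank_in lE l) => v _; rewrite mevalXU /g enum_rankK_in.
Qed.

Let polyg_row0 c : polyg (fun v => zrow v i0 c).
Proof.
have [|A hA] := @polyg_free (mxvec_index i0 (rho i0 c)).
  by rewrite mem_free_coords eqxx rho_idem eqxx.
exists A => v Sv; rewrite -hA // -(S_rho c Sv i0D).
by rewrite -[RHS]/(zrow _ _ _) zrow_of_rows (negPf i0D).
Qed.

Let polyg_fun0 F : polyfun F -> polyg (fun v => F (zrow v i0)).
Proof.
have /choice[A hA] := polyg_row0.
move=> [p hp]; exists (p \mPo [tuple A c | c < n]) => v Sv.
rewrite comp_mpoly_meval -hp; apply: meval_eq => c.
by rewrite tnth_mktuple hA.
Qed.

Let polyg_esym i c : i \in D -> polyg (fun v => esymv (zrow v i) c).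
Proof.
move=> iD; have [cr|rc] := ltnP c r.
  have [A hA] := polyg_fun0 (@polymap_esymv k n c).
  by exists A => v Sv; rewrite -hA // S_esym.
have [|A hA] := @polyg_free (mxvec_index i c); first by rewrite mem_free_coords iD rc orbT.
by exists A => v Sv; rewrite -hA // -[RHS]/(zrow _ _ _) zrow_of_rows iD.
Qed.

(** The coordinate is a root of [rootpoly], whose coefficients are polynomials in [g]: those of
    degree at most [r] come from row [i0], the others are free coordinates. *)
Let integral_D i c : i \in D -> integral_on S g (fun v => zrow v i c).
Proof.
move=> iD.
have /choice[A hA] (j : 'I_n.+1) : polyg (fun v => (mesym n k j).@[zrow v i]).
  case: j => -[|j] hj; last exact: (polyg_esym (Ordinal (hj : j < n)%N) iD).
  by exists 1 => v _; rewrite mesym0E !meval1.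
pose P := 'X^n + \poly_(j < n) ((-1) ^+ (n - j) * A (inord (n - j))).
have sP : (size (\poly_(j < n) ((-1) ^+ (n - j) * A (inord (n - j)))%R) < n.+1)%N.
  by rewrite ltnS size_poly.
exists P => [|v Sv]; first by rewrite /P monicE lead_coefDl ?lead_coefXn // size_polyXn.
suff -> : map_poly (meval (g v)) P = rootpoly (zrow v i).
  by rewrite /rootpoly (bigD1 c) //= rootM root_XsubC eqxx.
apply/polyP => j; rewrite coef_map /= coefD coefXn coef_poly.
have [jn|nj] := ltnP j n; last first.
  rewrite addr0; case: (ltngtP j n) nj => // [nj|->] _.
    by rewrite meval0 nth_default // size_rootpoly.
  have := monic_rootpoly (zrow v i); rewrite monicE lead_coefE size_rootpoly /= => /eqP->.
  by rewrite meval1.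
rewrite ltn_eqF // add0r rmorphM rmorphXn rmorphN rmorph1 /= -hA //.
have h : (n - j < n.+1)%N by rewrite ltnS leq_subr.
by have := coef_rootpoly (zrow v i) (Ordinal h); rewrite /= subKn ?inordK // ltnW.
Qed.

(** Such a row has at most [r] values, with multiplicities read off from [rho i]. As many of its
    power sums agree with those of row [i0], so [wpsum_integral] applies. *)
Let integral_special i c : i \notin D -> i != i0 -> integral_on S g (fun v => zrow v i c).
Proof.
move=> iD ne_i.
pose B := [set x in codom (rho i)].
have rB c' : rho i c' \in B by rewrite inE codom_f.
pose s := #|B|; pose w v : 'I_s -> k := fun j => zrow v i (enum_val j).
pose mu (j : 'I_s) := #|[set c' | rho i c' == enum_val j]|.
have sum_mu (V : nmodType) (F : 'I_n -> V) :
    \sum_c' F (rho i c') = \sum_j F (enum_val j) *+ mu j.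
  rewrite (partition_big (fun c' => enum_rank_in (rB c) (rho i c')) predT) //=.
  apply: eq_bigr => j _; rewrite -sumr_const; apply: eq_big => [c'|c' /eqP <-].
    rewrite inE; apply/eqP/eqP => [<-|->]; first by rewrite enum_rankK_in.
    by rewrite enum_valK_in.
  by rewrite enum_rankK_in.
have mu_gt0 j : (0 < mu j)%N.
  have := enum_valP j; rewrite inE => /codomP[c' hc'].
  by apply/card_gt0P; exists c'; rewrite inE hc'.
have sum_le : (\sum_j mu j <= n)%N.
  have := sum_mu nat (fun=> 1%N); rewrite sum_nat_const card_ord muln1 => ->.
  by rewrite leq_eqVlt; apply/orP; left; apply/eqP/eq_bigr => j _; rewrite -[RHS]mulr_natl mulr1 natn.
have s_le : (s <= r)%N by apply: leq_trans (card_rho iD ne_i); rewrite /s cardsE.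
have wE v t : S v -> wpsum mu (w v) t = \sum_c' zrow v i0 c' ^+ t.+1.
  move=> Sv; rewrite -(@power_sum_esymv _ _ (zrow v i) _ r); first last.
  - by rewrite /= (leq_trans (ltn_ord t)).
  - by move=> c' hc'; apply: S_esym.
  transitivity (\sum_c' zrow v i (rho i c') ^+ t.+1); last first.
    by apply: eq_bigr => c' _; rewrite S_rho.
  rewrite (sum_mu k (fun c' => zrow v i c' ^+ t.+1)).
  by apply: eq_bigr => j _; rewrite mulr_natl.
have /choice[A hA] (t : 'I_s) : polyg (fun v => wpsum mu (w v) t).
  have [|A hA] := @polyg_fun0 (fun z => \sum_c' z c' ^+ t.+1).
    exists (\sum_c' 'X_c' ^+ t.+1) => z; rewrite raddf_sum; apply: eq_bigr => c' _.
    by rewrite /= rmorphXn /= mevalXU.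
  by exists A => v Sv; rewrite wE // hA.
have [P mP hP] := wpsum_integral natr_neq0 mu_gt0 sum_le (enum_rank_in (rB c) (rho i c)).
exists (map_poly (comp_mpoly [tuple A t | t < s]) P) => [|v Sv].
  exact: monic_map.
have := hP (w v); rewrite {2}/w enum_rankK_in // S_rho //.
congr (root _ _); apply/polyP => j; rewrite !coef_map /= comp_mpoly_meval.
by apply: meval_eq => t; rewrite tnth_mktuple hA.
Qed.

Lemma rows_no_chain :
  ~ irr_chain S (#|[set c | rho i0 c == c]| + #|D| * (n - r)).+1.
Proof.
rewrite -(@card_free_coords m n r i0 D (rho i0) i0D); apply: (@integral_no_chain _ _ _ S g) => l.
case/mxvec_indexP: l => i c; have [iD|iD] := boolP (i \in D); first exact: integral_D.
have [->|ne] := eqVneq i i0; last exact: integral_special.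
by have [A hA] := polyg_row0 c; apply: (integral_on_polyfun (p := A)).
Qed.

End RowsUpperBound.

(** * The Jacobian *)

Section PuncturedSymmetricSums.
Variables (A : comNzRingType) (n : nat).
Implicit Types (z : 'I_n -> A) (d : nat) (c : 'I_n).

Definition esum z d := \sum_(s : {set 'I_n} | #|s| == d) \prod_(c in s) z c.

(** This is the partial derivative of [esum z d.+1] in the coordinate [c]. *)
Definition edel z d c := \sum_(s : {set 'I_n} | (#|s| == d) && (c \notin s)) \prod_(c' in s) z c'.

Lemma esumS z d c : esum z d.+1 = edel z d.+1 c + z c * edel z d c.
Proof.
rewrite /esum (bigID (fun s : {set 'I_n} => c \notin s)) /=; congr (_ + _).
rewrite mulr_sumr (reindex_onto (fun s => c |: s) (fun s => s :\ c)) /=; last first.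
  by move=> s /andP[_]; rewrite negbK => /setD1K.
apply: eq_big => [s|s /andP[/andP[_ _] /eqP hs]].
  rewrite setU11 andbT cardsU1; have [cs|cs] /= := boolP (c \in s).
    rewrite andbF; apply/negbTE; rewrite negb_and; apply/orP; right.
    by apply/eqP => /setP/(_ c); rewrite !inE eqxx cs.
  by rewrite setU1K // eqxx andbT.
rewrite big_setU1 //=; apply/negP => cs.
by move/setP: hs => /(_ c); rewrite !inE eqxx cs.
Qed.

Lemma edel0 z c : edel z 0 c = 1.
Proof.
rewrite /edel (big_pred1 set0) ?big_set0 // => s.
by rewrite cards_eq0 /=; have [->|] := eqVneq s set0; rewrite ?in_set0.
Qed.

(** The recursion solves [esumS] for [edel]; the index [c] enters only through the point of
    evaluation [z c]. *)
Fixpoint edel_poly z d : {poly A} :=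
  if d is d'.+1 then (esum z d)%:P - 'X * edel_poly z d' else 1.

Lemma edel_polyE z d c : edel z d c = (edel_poly z d).[z c].
Proof.
elim: d => [|d IH] /=; first by rewrite edel0 hornerC.
rewrite hornerD hornerN hornerC mulrC hornerMX -IH (esumS z d c).
by rewrite (mulrC _ (z c)) addrK.
Qed.

Lemma coef_edel_poly z d i : (d <= i)%N -> (edel_poly z d)`_i = (-1) ^+ d * (i == d)%:R.
Proof.
elim: d i => [|d IH] [|i] //= hi; rewrite ?coef1 ?mul1r //.
by rewrite coefB coefC coefXM /= sub0r IH // exprS mulN1r mulNr.
Qed.

End PuncturedSymmetricSums.

(** * Rows with few distinct coordinates *)

Section FewValues.
Variables (k : fieldType) (n r : nat).
Implicit Types z : 'I_n -> k.

(** The polynomial of index [b] has degree [b] with a sign as leading coefficient, so the family is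
    triangular. *)
Lemma edel_poly_free z s (la : nat -> k) :
  \sum_(b < s) la b *: edel_poly z b = 0 -> forall b, (b < s)%N -> la b = 0.
Proof.
elim: s => // s IH; rewrite big_ord_recr /= => h.
have las : la s = 0.
  move/(congr1 (fun p : {poly k} => p`_s)): h; rewrite coefD coefZ coef_sum big1 => [|b _].
    rewrite add0r coef_edel_poly // eqxx mulr1 coef0 => /eqP.
    by rewrite mulf_eq0 signr_eq0 orbF => /eqP.
  by rewrite coefZ coef_edel_poly 1?ltnW // gtn_eqF // !mulr0.
move: h; rewrite las scale0r addr0 => /IH h b; rewrite ltnS leq_eqVlt.
by case/orP=> [/eqP->|/h].
Qed.

(** The choice depends only on the value [z c], so the size of the image is the number of distinct
    values. As an idempotent self-map of a finite set, it is one of finitely many coincidence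
    patterns. *)
Definition first_index z c := odflt c [pick c' | z c' == z c].

Lemma first_indexE z c : z (first_index z c) = z c.
Proof. by rewrite /first_index; case: pickP => [c' /eqP|]. Qed.

Lemma first_index_ext z c c' : z c = z c' -> first_index z c = first_index z c'.
Proof.
rewrite /first_index => ->; case: pickP => // /(_ c'); by rewrite eqxx.
Qed.

Lemma first_index_idem z c : first_index z (first_index z c) = first_index z c.
Proof. exact/first_index_ext/first_indexE. Qed.

(** The relation is a nonzero polynomial of degree below [r] vanishing at every coordinate. *)
Lemma few_values z (la : 'I_r -> k) b : la b != 0 ->
  (forall c, \sum_b la b * edel z b c = 0) -> (#|codom (first_index z)| < r)%N.
Proof.
move=> lab h; pose la' i := if insub i is Some b then la b else 0.
have laE b' : la' (val b') = la b' by rewrite /la' valK.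
pose f := \sum_(b < r) la' b *: edel_poly z b.
have f0 : f != 0.
  by apply/eqP => /edel_poly_free/(_ b (ltn_ord b)) /eqP; rewrite laE (negPf lab).
have sf : (size f <= r)%N.
  apply/leq_sizeP => j hj; rewrite coef_sum big1 // => b' _.
  have lt_b : (b' < j)%N := leq_trans (ltn_ord b') hj.
  by rewrite coefZ coef_edel_poly ?(ltnW lt_b) // gtn_eqF // !mulr0.
apply: leq_trans sf; pose s := [seq z c | c <- enum (codom (first_index z))].
rewrite cardE -(size_map z) -/s; apply: max_poly_roots => //.
  apply/allP => _ /mapP[c _ ->]; rewrite /root -(h c) horner_sum; apply/eqP.
  by apply: eq_bigr => b' _; rewrite hornerZ laE edel_polyE.
rewrite map_inj_in_uniq ?enum_uniq // => x y.
rewrite !mem_enum => /codomP[c ->] /codomP[c' ->]; rewrite !first_indexE.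
exact: first_index_ext.
Qed.

(** There are [r] unknowns and fewer than [r] linear conditions, one for each element of the image
    of [rho]. *)
Lemma few_values_dependent z (rho : 'I_n -> 'I_n) :
  (forall c, z (rho c) = z c) -> (#|codom rho| < r)%N ->
  exists2 la : 'I_r -> k, exists b, la b != 0 & forall c, \sum_b la b * edel z b c = 0.
Proof.
move=> zrho lt_r; pose M : 'M[k]_(r, #|codom rho|) :=
  \matrix_(b, j) (edel_poly z b).[z (enum_val j)].
have : kermx M != 0.
  rewrite kermx_eq0 /row_free neq_ltn; apply/orP; left.
  exact: leq_ltn_trans (rank_leq_col M) lt_r.
case/rowV0Pn => u /sub_kermxP uM u0; exists (fun b => u 0 b).
  apply: contrapT => hb; case/eqP: u0; apply/rowP => b; rewrite mxE; apply/eqP.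
  by apply: contrapT => /negP ub; apply: hb; exists b.
move=> c; have := congr1 (fun B : 'rV_ _ => B 0 (enum_rank_in (codom_f rho c) (rho c))) uM.
rewrite /= !mxE => h; rewrite -[RHS]h; apply: eq_bigr => b _.
by rewrite mxE enum_rankK_in ?codom_f // zrho edel_polyE.
Qed.

End FewValues.

Section Jacobian.
Variables (k : closedFieldType) (m n h : nat).
Local Notation R := (n - h - 1)%N.
Implicit Types (v : 'I_(m * n) -> k).

Lemma meval_esum (y : 'I_n -> k) d : (mesym n k d).@[y] = esum y d.
Proof.
rewrite raddf_sum; apply: eq_bigr => s _ /=; rewrite rmorph_prod.
by apply: eq_bigr => c _; rewrite /= mevalXU.
Qed.

Lemma meval_esym_row v (i : 'I_m) d : (esym_row k n i d : {mpoly k[m * n]}).@[v] = esum (zrow v i) d.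
Proof.
rewrite raddf_sum; apply: eq_bigr => s _ /=; rewrite rmorph_prod.
by apply: eq_bigr => c _; rewrite /= mevalXU.
Qed.

Lemma meval_edel_zvar v (i : 'I_m) d (c : 'I_n) :
  (edel (zvar k i) d c).@[v] = edel (zrow v i) d c.
Proof.
rewrite raddf_sum; apply: eq_bigr => s _ /=; rewrite rmorph_prod.
by apply: eq_bigr => c' _; rewrite /= mevalXU.
Qed.

Lemma mderiv_prod_zvar0 l (i : 'I_m) (s : {set 'I_n}) :
  (forall c, c \in s -> mxvec_index i c != l) -> mderiv l (\prod_(c in s) zvar k i c) = 0.
Proof.
move=> hs; apply: (big_ind (fun p => mderiv l p = 0)) => [|p q hp hq|c cs].
- exact: mderivC.
- by rewrite mderivM hp hq mul0r mulr0 addr0.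
- by rewrite /zvar mderivX mnm1E (negPf (hs c cs)) scale0r.
Qed.

(** By [esumS] the polynomial is affine in the variable at [c], with slope [edel] free of that
    variable. *)
Lemma mderiv_esym_row (i i' : 'I_m) (c : 'I_n) d :
  mderiv (mxvec_index i' c) (esym_row k n i d.+1) = if i' == i then edel (zvar k i) d c else 0.
Proof.
have inj i1 c1 i2 c2 : mxvec_index i1 c1 = mxvec_index i2 c2 :> 'I_(m * n) -> i1 = i2 /\ c1 = c2.
  by move=> /(congr1 (@idx m n)); rewrite !mxvec_indexK => -[-> ->].
have [->|ne] := eqVneq i' i; last first.
  rewrite raddf_sum big1 // => s _; apply: mderiv_prod_zvar0 => c' _.
  by apply: contraNneq ne => /inj[->].
have edel0' e : mderiv (mxvec_index i c) (edel (zvar k i) e c) = 0.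
  rewrite raddf_sum big1 // => s /andP[_ cs]; apply: mderiv_prod_zvar0 => c' c's.
  by apply: contraNneq cs => /inj[_ <-].
rewrite -[esym_row _ _ _ _]/(esum (zvar k i) d.+1) (esumS _ d c) mderivD mderivM !edel0'.
rewrite mulr0 addr0 add0r /zvar mderivX mnm1E eqxx scale1r.
by rewrite (_ : (_ - _)%MM = 0%MM) ?mpolyX0 ?mul1r //; apply/mnmP => j; rewrite !mnmE subnn.
Qed.

Definition jac_entry v (i : 'I_m) (b : 'I_R) (i' : 'I_m) (c : 'I_n) : k :=
  if (i : nat) == 0%N then 0 else
  (if (i' : nat) == 0%N then edel (zrow v i') b c else 0) -
  (if i' == i then edel (zrow v i) b c else 0).

Lemma jacobianE v i b i' c :
  jacobian h v (enum_rank ((i, b) : eq_index m n h)) (mxvec_index i' c) = jac_entry v i b i' c.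
Proof.
rewrite mxE enum_rankK /Xeq /jac_entry; case: ifP => i0; first by rewrite mderiv0 meval0.
rewrite mderivB mevalB !mderiv_esym_row.
have -> : (i' == Defs.row1 i) = ((i' : nat) == 0%N) by rewrite -val_eqE.
congr (_ - _); case: ifP => hi'; rewrite ?meval0 ?meval_edel_zvar //.
by congr (edel (zrow v _) b c); apply: val_inj; rewrite /= (eqP hi').
Qed.

Lemma Xcone_esymv v : Xcone h v <->
  forall (i : 'I_m) (c : 'I_n), (c < R)%N -> esymv (zrow v (Defs.row1 i)) c = esymv (zrow v i) c.
Proof.
split=> [hv i c cR|hv [i b]]; last first.
  rewrite /Xeq; case: ifP => i0; first by rewrite meval0.
  rewrite mevalB !meval_esym_row; apply/eqP; rewrite subr_eq0; apply/eqP.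
  have lt_bn : (b < n)%N by apply: leq_trans (ltn_ord b) _; rewrite -subnDA leq_subr.
  by have := hv i (Ordinal lt_bn) (ltn_ord b); rewrite /esymv !meval_esum.
have := hv (i, Ordinal cR); rewrite /Xeq /=; case: ifP => [/eqP i0 _|_].
  by congr (esymv (zrow v _) c); apply: val_inj.
by rewrite mevalB !meval_esym_row /esymv !meval_esum => /eqP; rewrite subr_eq0 => /eqP.
Qed.

Lemma card_eq_index : #|{: eq_index m n h}| = (m * R)%N.
Proof. by rewrite card_prod !card_ord. Qed.

Lemma Singcone_few_values v : (0 < m)%N -> Singcone h v ->
  exists i j : 'I_m, [/\ i != j, (#|codom (first_index (zrow v i))| < R)%N &
    (#|codom (first_index (zrow v j))| < R)%N].
Proof.
move=> m0 [_ rk]; pose J := jacobian h v.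
pose o : 'I_m := Ordinal m0.
(* The equations of index [i = 0] give [R] zero rows. If every relation were supported on them, the
   kernel would have rank at most [R] and the Jacobian rank at least [ncodim]. *)
have [u uJ [[i1 b1] [i1n0 u1]]] : exists2 u : 'rV[k]_(#|{: eq_index m n h}|), u *m J = 0 &
    exists ib : eq_index m n h, (ib.1 : nat) != 0%N /\ u 0 (enum_rank ib) != 0.
  apply: contrapT => nu; move: rk; apply/negP; rewrite -leqNgt /ncodim -/J.
  pose K : 'M[k]_(R, #|{: eq_index m n h}|) :=
    \matrix_(b, r) (r == enum_rank ((o, b) : eq_index m n h))%:R.
  have /mxrankS : (kermx J <= K)%MS.
    apply/row_subP => r; have uJ : row r (kermx J) *m J = 0 by rewrite -row_mul mulmx_ker row0.
    move: (row r _) uJ => u uJ.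
    apply/submxP; exists (\row_b u 0 (enum_rank ((o, b) : eq_index m n h))).
    apply/rowP => r'; rewrite !mxE; have [[i b] ->] : exists ib : eq_index m n h, r' = enum_rank ib.
      by exists (enum_val r'); rewrite enum_valK.
    have [i0|i0] := eqVneq (i : nat) 0%N.
      have -> : i = o by apply: val_inj.
      rewrite (bigD1 b) //= !mxE eqxx mulr1 big1 ?addr0 ?mxE // => b' ne.
      rewrite !mxE (inj_eq enum_rank_inj) xpair_eqE eqxx /= eq_sym (negPf ne) mulr0 //.
    rewrite big1 => [|b' _].
      apply/eqP; apply: contrapT => /negP ub; apply: nu; exists u => //.
      by exists (i, b).
    rewrite !mxE (inj_eq enum_rank_inj) xpair_eqE -(val_eqE i) /= (negPf i0) mulr0 //.
  move=> /leq_trans/(_ (rank_leq_row K)); rewrite mxrank_ker.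
  rewrite [X in (X - _)%N]card_eq_index.
  by rewrite leq_subLR addnC -leq_subLR mulnBl mul1n.
(* Coefficients on the zero rows of the Jacobian are arbitrary and are reset to 0. *)
pose U (i : 'I_m) (b : 'I_R) := if (i : nat) == 0%N then 0 else u 0 (enum_rank ((i, b) : eq_index m n h)).
have hU i' c : \sum_i \sum_b U i b * jac_entry v i b i' c = 0.
  transitivity ((u *m J) 0 (mxvec_index i' c)); last by rewrite uJ mxE.
  rewrite mxE pair_big /= [RHS](reindex_onto enum_rank enum_val) /=; last first.
    by move=> ? _; rewrite enum_valK.
  apply: eq_big => [ib|[i b] _]; first by rewrite enum_rankK eqxx.
  by rewrite jacobianE /U /jac_entry; case: ifP; rewrite ?mulr0.
(* Derivatives in a row other than the first see only the equations of that row; derivatives in the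
   first row see the sum of all coefficients. *)
have row_dep i' c : i' != o -> \sum_b U i' b * edel (zrow v i') b c = 0.
  move=> ne; have n0 : ((i' : nat) == 0%N) = false by apply: contraNF ne => /eqP h0; apply/eqP/val_inj.
  apply: oppr_inj; rewrite oppr0 -[RHS](hU i' c) (bigD1 i') //= [X in _ = _ + X]big1 ?addr0.
    rewrite -sumrN; apply: eq_bigr => b _.
    by rewrite /jac_entry n0 eqxx sub0r mulrN.
  move=> i ni; apply: big1 => b _; rewrite /jac_entry n0 (eq_sym i' i) (negPf ni) subrr.
  by case: ifP; rewrite mulr0.
have row0_dep c : \sum_b (\sum_i U i b) * edel (zrow v o) b c = 0.
  rewrite -[RHS](hU o c) exchange_big; apply: eq_bigr => b _; rewrite mulr_suml.
  apply: eq_bigr => i _; rewrite /jac_entry /U; case: ifP => i0; first by rewrite !mul0r.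
  rewrite (_ : (o == i) = false) ?subr0 //.
  by apply: contraFF i0 => /eqP <-.
have i1o : i1 != o by apply: contraNneq i1n0 => ->.
have U1 : U i1 b1 != 0 by rewrite /U (negPf i1n0).
have few1 := few_values U1 (row_dep i1 ^~ i1o).
(* If the sum at [b1] is nonzero, the first row satisfies a nontrivial relation as well; otherwise a
   third row has a nonzero coefficient at [b1]. *)
have [s0|s0] := eqVneq (\sum_i U i b1) 0; last first.
  by exists i1, o; split=> //; apply: few_values s0 row0_dep.
have [i2 [ne2 U2]] : exists i2, i2 != i1 /\ U i2 b1 != 0.
  apply: contrapT => hn; move/eqP: s0; rewrite (bigD1 i1) //= big1 ?addr0 ?(negPf U1) //.
  move=> i ni; apply/eqP; apply: contrapT => /negP Ui; apply: hn; by exists i.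
have i2o : i2 != o by apply: contraNneq U2 => ->; rewrite /U eqxx.
exists i1, i2; rewrite eq_sym; split=> //.
exact: few_values U2 (row_dep i2 ^~ i2o).
Qed.

(** One relation [la] kills the derivatives in row [i1] and in the first row, as these rows are
    equal. Hence the Jacobian row of some [(i1, b0)] depends on the others with the same [i1]. *)
Lemma few_values_Singcone v (i1 : 'I_m) (rho : 'I_n -> 'I_n) :
  (i1 : nat) != 0%N -> Xcone h v -> zrow v i1 = zrow v (Defs.row1 i1) ->
  (forall c, zrow v i1 (rho c) = zrow v i1 c) -> (#|codom rho| < R)%N -> Singcone h v.
Proof.
move=> i1n0 Xv z1 zrho lt_R; split=> //.
have [la [b0 lab0] hla] := few_values_dependent zrho lt_R.
pose J := jacobian h v; pose o := Defs.row1 i1.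
(* Removing [(i1, b0)] from the equations with nonzero row index leaves [ncodim] minus one of
   them. *)
pose A : {set eq_index m n h} := [set ib : eq_index m n h | (ib.1 : nat) != 0%N] :\ (i1, b0).
pose K : 'M[k]_(#|A|, m * n) := \matrix_(a, l) J (enum_rank (enum_val a)) l.
have cA : (#|A| < ncodim m n h)%N.
  have := cardsD1 (i1, b0) [set ib : eq_index m n h | (ib.1 : nat) != 0%N].
  rewrite inE i1n0 add1n /A => <-; rewrite /ncodim.
  have -> : [set ib : eq_index m n h | (ib.1 : nat) != 0%N] = setX [set~ o] setT.
    by apply/setP => -[i b]; rewrite !inE /= -(val_eqE i) andbT.
  by rewrite cardsX cardsC1 cardsT !card_ord -subn1.
apply: leq_ltn_trans cA; rewrite -/J.
suff /mxrankS h1 : (J <= K)%MS by apply: leq_trans h1 (rank_leq_row K).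
have rowK (ib : eq_index m n h) : ib \in A -> (row (enum_rank ib) J <= K)%MS.
  move=> iA; rewrite (_ : row _ J = row (enum_rank_in iA ib) K) ?row_sub //.
  by apply/rowP => l; rewrite !mxE enum_rankK_in.
apply/row_subP => r; have [[i b] ->] : exists ib : eq_index m n h, r = enum_rank ib.
  by exists (enum_val r); rewrite enum_valK.
have [i0|i0] := eqVneq (i : nat) 0%N.
  rewrite (_ : row _ J = 0) ?sub0mx //; apply/rowP => l; case/mxvec_indexP: l => i' c.
  by rewrite mxE jacobianE /jac_entry i0 eqxx mxE.
have [[-> ->]|ne] := eqVneq (i, b) (i1, b0); last by apply: rowK; rewrite !inE ne.
have rel : \sum_b la b *: row (enum_rank ((i1, b) : eq_index m n h)) J = 0.
  apply/rowP => l; case/mxvec_indexP: l => i' c; rewrite summxE mxE.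
  under eq_bigr => b' _ do rewrite mxE [X in _ * X]mxE jacobianE /jac_entry (negPf i1n0) mulrBr.
  rewrite sumrB; have e1 : \sum_b' la b' * (if i' == i1 then edel (zrow v i1) b' c else 0) = 0.
    by case: (i' == i1); [exact: hla | rewrite big1 // => b' _; rewrite mulr0].
  rewrite e1 subr0; have [i'0|_] := boolP ((i' : nat) == 0%N); last by rewrite big1 // => b' _; rewrite mulr0.
  have -> : i' = o by apply: val_inj; apply/eqP.
  by rewrite -z1; exact: hla.
have -> : row (enum_rank ((i1, b0) : eq_index m n h)) J =
    - (la b0)^-1 *: \sum_(b' | b' != b0) la b' *: row (enum_rank ((i1, b') : eq_index m n h)) J.
  move: rel; rewrite (bigD1 b0) //= => /eqP; rewrite addr_eq0 => /eqP e.
  by rewrite scaleNr -scalerN -e scalerA mulVf ?scale1r.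
apply/scalemx_sub/summx_sub => b' ne'; apply/scalemx_sub/rowK.
by rewrite !inE xpair_eqE eqxx ne'.
Qed.

End Jacobian.

(** * Dimensions *)

(** The largest member of the chain is irreducible, so it lies in one [A i], and the smaller members
    follow. *)
Lemma irr_chain_subU (k : closedFieldType) N (S : aset k N) (I : eqType) (s : seq I)
  (A : I -> aset k N) d : irr_chain S d -> (forall i, zariski_closed (A i)) ->
  (forall v, S v -> exists2 i, i \in s & A i v) ->
  exists2 i, i \in s & irr_chain (fun v => S v /\ A i v) d.
Proof.
move=> [Z [h1 h2]] cA hS; have [iZ sZ] := h1 d (leqnn d).
have [v /sZ /hS //|i si hi] := irreducible_subU iZ cA (s := s).
exists i => //; exists Z; split=> // j jd; have [iZj sZj] := h1 j jd; split=> // v Zv.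
split; first exact: sZj.
apply: hi; elim: d jd h2 {h1 iZ sZ} => [|d IH]; first by rewrite leqn0 => /eqP <-.
rewrite leq_eqVlt => /orP[/eqP <- //|jd] h2; have [sd _] := h2 d (leqnn _).
by apply/sd/IH => // j' hj'; apply/h2/leqW.
Qed.

Lemma pchar_gt_natr_neq0 (k : fieldType) n : (forall p, p \in [pchar k] -> (n < p)%N) ->
  forall j, (0 < j <= n)%N -> (j%:R : k) != 0.
Proof.
move=> hchar j /andP[j0 jn]; apply/negP => jk.
have [p pk] := natf0_pchar j0 jk.
have := hchar p pk; rewrite ltnNge (leq_trans _ jn) // dvdn_leq //.
by rewrite (dvdn_pcharf pk).
Qed.

Lemma card_ord_lt n s : (s <= n)%N -> #|[set c : 'I_n | (c < s)%N]| = s.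
Proof.
move=> sn; rewrite cardsE -sum1_card -(big_ord_widen n (fun=> 1%N)) //.
by rewrite sum_nat_const card_ord muln1.
Qed.

Lemma glue_rows (k : closedFieldType) m n r (i0 : 'I_m) (D : {set 'I_m})
  (rho : 'I_n -> 'I_n) (v : 'I_(m * n) -> k) : i0 \notin D ->
  glue r i0 D rho (symrows D v) = symrows D v ->
  (forall i, i \notin D -> zrow v i = zrow v i0 \o rho) /\
  forall i (c : 'I_n), i \in D -> (c < r)%N -> esymv (zrow v i) c = esymv (zrow v i0) c.
Proof.
move=> i0D /(congr1 (@zrow k m n)) h.
have hrow i c : i \notin D -> zrow v i c = zrow v i0 (rho c).
  move=> iD; have /(congr1 (fun f => f c)) := congr1 (fun f => f i) h.
  by rewrite /= !zrow_of_rows (negPf iD) (negPf i0D).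
split=> [i iD|i c iD cr]; first by apply/funext => c; apply: hrow.
have /(congr1 (fun f => f c)) := congr1 (fun f => f i) h.
rewrite /= !zrow_of_rows iD (negPf i0D) cr => <-; congr (esymv _ c).
by apply/funext => c'; rewrite /= -(hrow i0 c').
Qed.

Section Dimensions.
Variables (k : closedFieldType) (m n h : nat).
Local Notation R := (n - h - 1)%N.
Hypotheses (natr_neq0 : forall j, (0 < j <= n)%N -> (j%:R : k) != 0)
  (m_ge2 : (2 <= m)%N) (R_ge2 : (2 <= R)%N).

Let o : 'I_m := Ordinal (ltnW m_ge2).

Let R_le : (R <= n)%N. Proof. by rewrite -subnDA leq_subr. Qed.

Let row1E (i : 'I_m) : Defs.row1 i = o. Proof. exact: val_inj. Qed.

(** The first row is free, with [rho] the identity, and all others are symmetrized, so the condition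
    on special rows is vacuous. *)
Lemma Xcone_has_dim : has_dim (@Xcone k m n h) (n + (m - 1) * (n - R))%N.
Proof.
have oD : o \notin [set~ o] by rewrite !inE eqxx.
have card_id : #|[set c : 'I_n | id c == c]| = n.
  by rewrite -[RHS]card_ord -cardsT; apply: eq_card => c; rewrite !inE eqxx.
have cardD : #|[set~ o]| = (m - 1)%N by rewrite cardsC1 card_ord subn1.
split.
  have := @glue_chain k m n R o [set~ o] id oD (fun=> erefl).
  rewrite card_free_coords // card_id cardD; apply: irr_chain_sub => v.
  move=> /(glue_rows oD)[_ h2]; apply/Xcone_esymv => i c cR; rewrite row1E.
  by have [->//|ne] := eqVneq i o; rewrite h2 // !inE.
have := @rows_no_chain k m n R (@Xcone k m n h) o [set~ o] (fun=> id) natr_neq0 oD.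
rewrite card_id cardD; apply=> // [v i c /Xcone_esymv/(_ i c) hv cR|i].
  by rewrite -hv // row1E.
by rewrite !inE negbK => /eqP-> /eqP.
Qed.

(** The chain lives where the first two rows coincide and have at most [R - 1] values. *)
Lemma Singcone_chain : irr_chain (@Singcone k m n h) ((R - 1) + (m - 2) * (n - R))%N.
Proof.
pose D := [set i : 'I_m | (2 <= i)%N].
have oD : o \notin D by rewrite inE.
have n0 : (0 < n)%N by apply: leq_trans R_le; apply: ltnW.
(* Positions from [R - 1] on repeat position 0, which is itself fixed because [R] is at least 2. *)
pose rho (c : 'I_n) := if (c < R.-1)%N then c else Ordinal n0.
have R1 : (0 < R.-1)%N by rewrite -subn1 subn_gt0.
have rho_lt c : (rho c < R.-1)%N by rewrite /rho; case: ifP.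
have rho_idem c : rho (rho c) = rho c by rewrite {1}/rho rho_lt.
have lt_le : (R.-1 <= n)%N by rewrite (leq_trans (leq_pred _)).
have card_fix : #|[set c | rho c == c]| = (R - 1)%N.
  rewrite subn1 -[RHS](card_ord_lt lt_le); apply: eq_card => c; rewrite !inE.
  by apply/eqP/idP => [<-|hc] //; rewrite /rho hc.
have card_rho : (#|codom rho| < R)%N.
  rewrite -(prednK (ltnW R_ge2)) ltnS -[leqRHS](card_ord_lt lt_le).
  by apply: subset_leq_card; apply/subsetP => _ /codomP[c ->]; rewrite inE.
have cardD : #|D| = (m - 2)%N.
  have := cardsC [set c : 'I_m | (c < 2)%N]; rewrite card_ord_lt // card_ord => e.
  rewrite -[X in (X - _)%N]e addKn; apply: eq_card => i; by rewrite !inE -leqNgt.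
have := @glue_chain k m n R o D rho oD rho_idem.
rewrite card_free_coords // card_fix cardD; apply: irr_chain_sub => v.
move=> /(glue_rows oD)[h1 h2]; pose o1 : 'I_m := Ordinal m_ge2.
have z1 : zrow v o1 = zrow v o by rewrite [RHS]h1 // h1 // inE.
apply: (@few_values_Singcone _ _ _ _ v o1 rho) => // [||c].
- apply/Xcone_esymv => i c cR; rewrite row1E.
  have [iD|iD] := boolP (i \in D); first by rewrite h2.
  by rewrite (h1 i iD) -(h1 o oD).
- by rewrite row1E.
- by rewrite z1 (h1 o oD) /= rho_idem.
Qed.

(** Finitely many closed sets, indexed by two rows and their coincidence patterns, cover the
    singular cone, and a chain lies in one of them. There row [i] is the base row and row [j] the
    special one. *)
Lemma Singcone_no_chain : ~ irr_chain (@Singcone k m n h) ((R - 1) + (m - 2) * (n - R)).+1.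
Proof.
pose F := {ffun 'I_n -> 'I_n}.
pose few (f : F) := [forall c, f (f c) == f c] && (#|codom f| < R)%N.
pose s := [seq x : 'I_m * 'I_m * (F * F) <- enum {: 'I_m * 'I_m * (F * F)} |
  [&& x.1.1 != x.1.2, few x.2.1 & few x.2.2]].
pose A (x : 'I_m * 'I_m * (F * F)) (v : 'I_(m * n) -> k) :=
  (forall c, zrow v x.1.1 (x.2.1 c) = zrow v x.1.1 c) /\
  (forall c, zrow v x.1.2 (x.2.2 c) = zrow v x.1.2 c).
have cA x : zariski_closed (A x).
  by apply: zariski_closedI; apply: zariski_closed_eq => c; apply: polyfun_coord.
move=> ch0; have [v Sv|[[i j] [f f']] + ch] := irr_chain_subU (s := s) ch0 cA.
  have [i [j [ij fi fj]]] := Singcone_few_values (ltnW m_ge2) Sv.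
  have fewP (z : 'I_n -> k) : (#|codom (first_index z)| < R)%N -> few [ffun c => first_index z c].
    move=> fz; apply/andP; split; first by apply/forallP => c; rewrite !ffunE first_index_idem.
    apply: leq_ltn_trans fz; apply: subset_leq_card; apply/subsetP => _ /codomP[c ->].
    by rewrite ffunE codom_f.
  exists (i, j, ([ffun c => first_index (zrow v i) c], [ffun c => first_index (zrow v j) c])).
    by rewrite mem_filter mem_enum /= ij !fewP.
  by split=> c; rewrite ffunE first_indexE.
rewrite mem_filter /= => /andP[/and3P[ij /andP[/forallP idf cf] /andP[_ cf']] _].
pose D := ~: [set i; j].
have iD : i \notin D by rewrite !inE eqxx.
have cardD : #|D| = (m - 2)%N by rewrite cardsCs setCK cards2 ij card_ord.
pose rho a := if a == i then f : 'I_n -> 'I_n else f'.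
apply: (@rows_no_chain k m n R (fun v => Xcone h v /\ A (i, j, (f, f')) v) i D rho) => //.
- by move=> c; rewrite /rho eqxx; apply/eqP.
- move=> v a c [_ [hi hj]]; rewrite !inE negbK /rho => /orP[]/eqP->; first by rewrite eqxx.
  by rewrite eq_sym (negPf ij).
- by move=> v a c [/Xcone_esymv hv _] cR; rewrite -(hv a) // -(hv i) // !row1E.
- move=> a; rewrite !inE negbK => /orP[/eqP->/eqP//|/eqP->]; rewrite eq_sym => _.
  by rewrite /rho eq_sym (negPf ij) ltnW.
(* Fixed points of the pattern lie in its image, which has fewer than [R] elements. *)
have le_fix : (#|[set c | rho i c == c]| <= R - 1)%N.
  rewrite /rho eqxx subn1 -ltnS prednK ?(ltnW R_ge2) //; apply: leq_ltn_trans cf.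
  by apply: subset_leq_card; apply/subsetP => c; rewrite inE => /eqP <-; apply: codom_f.
apply: irr_chain_leq (irr_chain_sub _ ch) => [|v [[]] //].
by rewrite cardD ltnS leq_add2r.
Qed.

End Dimensions.

Theorem theorem2p7 (k : closedFieldType) (m n h : nat)
  (hchar : forall p : nat, p \in [pchar k]%R -> (n < p)%N)
  (hm : (2 <= m)%N) (hn : (4 <= n)%N) (hh1 : (1 <= h)%N) (hh2 : (h <= n - 3)%N) :
  exists dX dS : nat,
    has_dim (@Xcone k m n h) dX /\ has_dim (@Singcone k m n h) dS /\
    dX = (dS + (2 * h + 3))%N.
Proof.
have natr_neq0 := pchar_gt_natr_neq0 hchar.
have hR : (2 <= n - h - 1)%N by lia.
(* With [R = n - h - 1], the difference is [n - (R - 1) = h + 2] plus [n - R = h + 1] for one more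
   symmetrized row. *)
exists (n + (m - 1) * (n - (n - h - 1)))%N, (((n - h - 1) - 1) + (m - 2) * (n - (n - h - 1)))%N.
split; first exact: Xcone_has_dim.
split; first by split; [exact: Singcone_chain | exact: Singcone_no_chain].
have -> : (m - 1 = (m - 2).+1)%N by lia.
rewrite mulSn; lia.
Qed.
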